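(* For each $d\in\mathbb{N}$ there exists a constant $C_d$ such that for all $B\in\mathrm{GL}(d,\mathbb{R})$ and all $1\le k<d$, $$\left|\int\log\frac{s_1(B|_{V_{k+1}\perp V_{k-1}})}{s_2(B|_{V_{k+1}\perp V_{k-1}})}\,d\lambda_{k-1,k+1}(V_{k-1},V_{k+1})-\log\frac{s_k(B)}{s_{k+1}(B)}\right|\le C_d .$$
   Context: $s_i(A)$ denotes the $i$th largest singular value. $\mathrm{proj}_W$ is orthogonal projection onto $W$. For nested subspaces $U\subseteq V$ of $\mathbb{R}^d$, $V\ominus U$ is the orthogonal complement of $U$ in $V$, and $B|_{V\perp U}=\mathrm{proj}_{B(V)\ominus B(U)}\,B\,\mathrm{proj}_{V\ominus U}$. $\mathrm{PF}(k-1,k+1)$ is the space of partial flags $V_{k-1}\subset V_{k+1}\subseteq\mathbb{R}^d$ with $\dim V_i=i$, and $\lambda_{k-1,k+1}$ is the normalized Haar measure on it, i.e. the probability measure invariant under the action of the orthogonal group. *)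

(* Defs.v *)
From HB Require Import structures.
From mathcomp Require Import all_boot all_order all_algebra.
From mathcomp Require Import polyrcf.
From mathcomp Require Import all_classical all_reals all_analysis.
Set Implicit Arguments.
Unset Strict Implicit.
Unset Printing Implicit Defensive.
Import Order.TTheory GRing.Theory Num.Theory.
Import numFieldNormedType.Exports.
Local Open Scope classical_set_scope.
Local Open Scope ring_scope.

Section SingularValues.
Context {R : realType} {d : nat}.

(* Square roots of the eigenvalues of A^T A in decreasing order; rootsR lists
   each root once, so multiplicities are restored by mup. *)
Definition singular_values (A : 'M[R]_d) : seq R :=
  let p := char_poly (A^T *m A) in
  sort >=%R
    (map Num.sqrt (flatten [seq nseq (mup x p) x | x <- rootsR p])).

(* 1-based: [singular_value A 1] is the largest singular value. *)
Definition singular_value (A : 'M[R]_d) (i : nat) : R :=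
  (singular_values A)`_i.-1.

End SingularValues.

Section Subspaces.
Context {R : realType} {d : nat}.
Implicit Types (U V W : {vspace 'cV[R]_d}) (B : 'M[R]_d).

Definition orthocomp U : {vspace 'cV[R]_d} :=
  (\bigcap_(i < \dim U) lker (linfun (mulmx ((vbasis U)`_i)^T)))%VS.

Lemma orthocompP U (v : 'cV[R]_d) :
  reflect (forall u, u \in U -> u^T *m v = 0) (v \in orthocomp U).
Proof.
apply: (iffP idP) => [|vU].
  rewrite memvE => /subv_bigcapP vb u uU.
  rewrite (coord_vbasis uU) linear_sum mulmx_suml big1// => i _.
  have := vb i isT; rewrite -memvE memv_ker lfunE /= => /eqP vi0.
  by rewrite linearZ -scalemxAl vi0 scaler0.
rewrite memvE; apply/subv_bigcapP => i _; rewrite -memvE memv_ker lfunE /=.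
by apply/eqP/vU/vbasis_mem/mem_nth; rewrite size_tuple.
Qed.

Definition ominus V U : {vspace 'cV[R]_d} := (V :&: orthocomp U)%VS.

Definition proj W : 'M[R]_d :=
  \matrix_(i, j) daddv_pi W (orthocomp W) (delta_mx j 0) i 0.

Lemma capv_orthocomp W : (W :&: orthocomp W = 0)%VS.
Proof.
apply/eqP; rewrite -subv0; apply/subvP => v.
rewrite memv_cap => /andP[vW /orthocompP/(_ v vW)] /matrixP/(_ 0 0).
rewrite !mxE => vv0.
have {vv0}v0 : forall i, v i 0 = 0.
  move=> i; have := @psumr_eq0P R _ xpredT (fun j => v^T 0 j * v j 0).
  move=> /(_ (fun j _ => _) vv0 i isT) /=.
  rewrite mxE => h; apply/eqP; rewrite -sqrf_eq0 expr2; apply/eqP/h => j.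
  by rewrite mxE -expr2 sqr_ge0.
by rewrite memv0; apply/eqP/matrixP => i j; rewrite ord1 v0 mxE.
Qed.

Lemma addv_orthocomp W : (W + orthocomp W = fullv)%VS.
Proof.
pose f : 'Hom('cV[R]_d, 'cV[R]_(\dim W)) :=
  linfun (mulmx (\matrix_(i < \dim W) ((vbasis W)`_i)^T)).
have kf : (lker f <= orthocomp W)%VS.
  apply/subvP => v; rewrite memv_ker lfunE /= => /eqP fv0; rewrite memvE.
  apply/subv_bigcapP => i _; rewrite -memvE memv_ker lfunE /=.
  by rewrite -[X in X *m v](rowK (fun i : 'I_(\dim W) => ((vbasis W)`_i)^T)) -row_mul fv0 row0.
apply/eqP; rewrite eqEdim subvf /= dimv_disjoint_sum ?capv_orthocomp//.
rewrite -(limg_ker_dim f fullv) capfv addnC leq_add ?dimvS//.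
by rewrite (leq_trans (dimvS (subvf _)))// dimvf /dim /= muln1.
Qed.

Lemma mul_proj W (v : 'cV[R]_d) :
  proj W *m v = daddv_pi W (orthocomp W) v.
Proof.
rewrite [in RHS](matrix_sum_delta v) linear_sum; apply/matrixP => i j.
rewrite ord1 summxE mxE; apply: eq_bigr => l _.
by rewrite big_ord1 linearZ !mxE mulrC.
Qed.

Lemma proj_mem W (v : 'cV[R]_d) : proj W *m v \in W.
Proof. by rewrite mul_proj memv_pi. Qed.

Lemma proj_orth W (v : 'cV[R]_d) : v - proj W *m v \in orthocomp W.
Proof.
rewrite mul_proj.
have := @daddv_pi_add _ _ W (orthocomp W) v (capv_orthocomp W).
rewrite addv_orthocomp memvf => /(_ isT) {1}<-.
by rewrite addrC addKr memv_pi.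
Qed.

Definition mximg B V : {vspace 'cV[R]_d} := (linfun (mulmx B) @: V)%VS.

(* B|_{V \perp U} for U <= V. *)
Definition mxrestr B V U : 'M[R]_d :=
  proj (ominus (mximg B V) (mximg B U)) *m B *m proj (ominus V U).

Lemma dim_mximg B V : B \in unitmx -> \dim (mximg B V) = \dim V.
Proof.
move=> Bu; apply: limg_dim_eq; apply/eqP; rewrite -subv0; apply/subvP => v.
rewrite memv_cap memv_ker lfunE /= memv0 => /andP[_ /eqP Bv0].
by rewrite -(mulKmx Bu v) Bv0 mulmx0.
Qed.

End Subspaces.

Section PartialFlags.
Context {R : realType} {d : nat}.
Local Notation vsp := {vspace 'cV[R]_d}.

Definition is_flag (k : nat) (V : vsp * vsp) : bool :=
  [&& (V.1 <= V.2)%VS, \dim V.1 == k.-1 & \dim V.2 == k.+1].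

(* PF(k-1, k+1); the bounds on k ensure that the space is inhabited. *)
Definition PF (k : nat) (hk : (1 <= k < d)%N) := {V : vsp * vsp | is_flag k V}.

Lemma dim_span_take i : (i <= d)%N ->
  \dim <<take i (vbasis (fullv : vsp))>>%VS = i.
Proof.
move=> id; have dimE : \dim (fullv : vsp) = d by rewrite dimvf /dim /= muln1.
have /eqP -> : free (take i (vbasis (fullv : vsp))).
  by have := basis_free (vbasisP (fullv : vsp));
    rewrite -{1}(cat_take_drop i (vbasis _)) => /catl_free.
by rewrite size_takel// size_tuple dimE.
Qed.

Lemma standard_flag k : (1 <= k < d)%N ->
  is_flag k (<<take k.-1 (vbasis (fullv : vsp))>>%VS,
             <<take k.+1 (vbasis (fullv : vsp))>>%VS).
Proof.
case: k => // k /= kd; apply/and3P; split => /=.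
- apply/sub_span => x; set s := vbasis _.
  by rewrite -(@take_takel _ k k.+2 s (leq_trans (leqnSn k) (leqnSn _))) => /mem_take.
- by apply/eqP/dim_span_take/ltnW/ltnW.
- exact/eqP/dim_span_take.
Qed.

Section Structures.
Context (k : nat) (hk : (1 <= k < d)%N).

HB.instance Definition _ := Choice.on (PF hk).
HB.instance Definition _ :=
  isPointed.Build (PF hk) (exist (is_flag k) _ (standard_flag hk)).

Definition flag_proj (V : PF hk) : 'M[R]_d * 'M[R]_d :=
  (proj (val V).1, proj (val V).2).

(* A flag is topologized through the orthogonal projections on its members:
   this is the usual topology of the flag manifold. *)
HB.instance Definition _ :=
  Topological.copy (PF hk) (initial_topology flag_proj).

Definition borelPF := g_sigma_algebraType (@open (PF hk)).

End Structures.

Definition orthogonal_group := {Q : 'M[R]_d | Q^T *m Q == 1%:M}.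

Lemma orthogonal_unit (Q : orthogonal_group) : val Q \in unitmx.
Proof. by case: Q => Q /= /eqP /mulmx1_unit []. Qed.

Lemma is_flag_act k (Q : orthogonal_group) (V : vsp * vsp) :
  is_flag k V -> is_flag k (mximg (val Q) V.1, mximg (val Q) V.2).
Proof.
by case/and3P => V12 d1 d2; rewrite /is_flag /= limgS// !dim_mximg
  ?orthogonal_unit// d1 d2.
Qed.

Definition flag_act k (hk : (1 <= k < d)%N) (Q : orthogonal_group)
    (V : PF hk) : PF hk :=
  exist (is_flag k) _ (is_flag_act Q (valP V)).

(* These conditions determine the measure: O(d) is compact and acts
   transitively on PF. *)
Definition is_haar k (hk : (1 <= k < d)%N) (lambda : probability (borelPF hk) R) :=
  forall (Q : orthogonal_group) (A : set (borelPF hk)),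
    measurable A -> lambda (flag_act Q @^-1` A) = lambda A.

End PartialFlags.
Arguments PF R {d k} hk.
Arguments borelPF R {d k} hk.

(* Main.v *)
Require Import Defs.
From HB Require Import structures.
From mathcomp Require Import all_boot all_order all_algebra.
From mathcomp Require Import fingroup perm spectral polyrcf complex ring lra zify.
From mathcomp Require Import all_classical all_reals all_analysis.
From mathcomp Require Import measurable_realfun simple_functions.
Set Implicit Arguments.
Unset Strict Implicit.
Unset Printing Implicit Defensive.
Import Order.TTheory GRing.Theory Num.Theory.
Import numFieldNormedType.Exports.
Import Defs HBNNSimple.
Local Open Scope classical_set_scope.
Local Open Scope ring_scope.

(** Write s for the singular values of B and let the columns of O be the
    matching right singular vectors, W_m the span of the first m of them.  Put
    U = V_(k-1), V = V_(k+1) and A = mxrestr B V U.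

    The deterministic part compares A with B as soon as U is transverse to the
    orthogonal complement of W_(k-1), and V to that of W_(k+1).  If the
    projection to W_(k-1) keeps at least the fraction a of the squared length of
    every vector of U, and the projection to W_(k+1) at least the fraction b of
    that of every vector of V, then
      b s_k(B)^2 <= s_1(A)^2 <= (1 + 1/a) s_k(B)^2,
      b s_(k+1)(B)^2 <= s_2(A)^2 <= (1 + 1/a) s_(k+1)(B)^2.
    All four follow from minimax and from the fact that |A v| is the distance
    from B v to B U: an upper bound needs one good u in U to subtract from v, a
    lower bound a bound on B (v - u) for all u.  Hence the two log ratios differ
    by at most ln 2 - ln a - ln b (restr_singular1_le and its three companions,
    ln_ratio_close).  For a and b one may take the overlap determinants of
    the corresponding projections (transverse_overlap).

    It remains to bound the mean of - ln (overlap) over the flags, uniformly in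
    B.  Invariance of the measure permits averaging over finitely many orthogonal
    matrices: take products of d reflections whose normal vectors have entries in
    {0, 1/N, ..., (N-1)/N}.  Up to a bounded factor, the overlap of the moved
    subspace is a polynomial in these entries; since every subspace of dimension
    m can be carried by d reflections to the span of the first m basis vectors,
    this polynomial takes the value 1 at a point whose coordinates lie in
    [-1, 1] (overlap_poly_attains). A polynomial of degree n in each variable
    that is not small somewhere is small only at a fraction O(1/N) of the grid
    (count_grid), where small means below a constant times a fixed power of 1/N.
    By invariance, the set of flags whose overlap lies below that level has
    measure O(1/N) (low_overlap_tail). Taking N = 2^j, the function - ln
    (overlap) is dominated by an affine function of the number of levels that
    the overlap falls below, and this number has finite mean
    (overlap_log_dominated).

    The integrand is nonnegative and squeezed between measurable functions, and
    the integral is monotone on all nonnegative functions; this gives the claim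
    (ge0_integral_le, integral_close). *)

(** * Inner products, orthogonal matrices and reflections *)

Section Dot.
Context {R : realType}.

Definition dot {n} (u v : 'cV[R]_n) : R := (u^T *m v) 0 0.

Lemma dotE n (u v : 'cV[R]_n) : dot u v = \sum_i u i 0 * v i 0.
Proof. by rewrite /dot mxE; apply: eq_bigr => i _; rewrite mxE. Qed.

Lemma dotC n (u v : 'cV[R]_n) : dot u v = dot v u.
Proof. by rewrite !dotE; apply: eq_bigr => i _; rewrite mulrC. Qed.

Lemma dotDr n (u v w : 'cV[R]_n) : dot u (v + w) = dot u v + dot u w.
Proof. by rewrite /dot mulmxDr mxE. Qed.

Lemma dotDl n (u v w : 'cV[R]_n) : dot (v + w) u = dot v u + dot w u.
Proof. by rewrite dotC dotDr !(dotC u). Qed.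

Lemma dotNr n (u v : 'cV[R]_n) : dot u (- v) = - dot u v.
Proof. by rewrite /dot mulmxN mxE. Qed.

Lemma dotNl n (u v : 'cV[R]_n) : dot (- u) v = - dot u v.
Proof. by rewrite dotC dotNr dotC. Qed.

Lemma dotZr n a (u v : 'cV[R]_n) : dot u (a *: v) = a * dot u v.
Proof. by rewrite /dot -scalemxAr mxE. Qed.

Lemma dotZl n a (u v : 'cV[R]_n) : dot (a *: u) v = a * dot u v.
Proof. by rewrite dotC dotZr dotC. Qed.

Lemma dot0r n (u : 'cV[R]_n) : dot u 0 = 0.
Proof. by rewrite /dot mulmx0 mxE. Qed.

Lemma dot0l n (u : 'cV[R]_n) : dot 0 u = 0.
Proof. by rewrite dotC dot0r. Qed.

Lemma dotMr m n (A : 'M[R]_(m, n)) u v : dot u (A *m v) = dot (A^T *m u) v.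
Proof. by rewrite /dot trmx_mul trmxK mulmxA. Qed.

Lemma dotMl m n (A : 'M[R]_(m, n)) u v : dot (A *m u) v = dot u (A^T *m v).
Proof. by rewrite dotC dotMr dotC. Qed.

Lemma dot_ge0 n (u : 'cV[R]_n) : 0 <= dot u u.
Proof. by rewrite dotE; apply: sumr_ge0 => i _; rewrite -expr2 sqr_ge0. Qed.

Lemma dot_eq0 n (u : 'cV[R]_n) : (dot u u == 0) = (u == 0).
Proof.
apply/idP/eqP => [|->]; last by rewrite dot0r.
rewrite dotE psumr_eq0; last by move=> i _; rewrite -expr2 sqr_ge0.
move=> /allP u0; apply/colP => i; rewrite mxE.
by have := u0 i (mem_index_enum _); rewrite /= -expr2 sqrf_eq0 => /eqP.
Qed.

Lemma dot_gt0 n (u : 'cV[R]_n) : (0 < dot u u) = (u != 0).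
Proof. by rewrite lt_def dot_eq0 dot_ge0 andbT. Qed.

Lemma cauchy_schwarz n (u v : 'cV[R]_n) : dot u v ^+ 2 <= dot u u * dot v v.
Proof.
have [->|v0] := eqVneq v 0; first by rewrite !dot0r expr0n mulr0.
have vp : 0 < dot v v by rewrite dot_gt0.
have := dot_ge0 (dot v v *: u - dot u v *: v).
rewrite !(dotDr, dotDl, dotNr, dotNl, dotZr, dotZl) (dotC v u).
set a := dot u u; set b := dot v v in vp *; set c := dot u v => h.
have : 0 <= b * (a * b - c ^+ 2) by nra.
by rewrite pmulr_rge0// subr_ge0.
Qed.

Lemma dot_orth n (u v : 'cV[R]_n) : dot u v = 0 ->
  dot (u + v) (u + v) = dot u u + dot v v.
Proof. by rewrite !dotDr !dotDl (dotC v u) => ->; ring. Qed.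

Lemma dot_delta n (i : 'I_n) (v : 'cV[R]_n) : dot (delta_mx i 0) v = v i 0.
Proof.
rewrite dotE (bigD1 i)//= mxE !eqxx mul1r big1 ?addr0// => j ji.
by rewrite mxE (negbTE ji) mul0r.
Qed.

Lemma dot_col m n p (A : 'M[R]_(n, m)) (B : 'M[R]_(n, p)) i j :
  dot (col i A) (col j B) = (A^T *m B) i j.
Proof. by rewrite dotE mxE; apply: eq_bigr => k _; rewrite !mxE. Qed.

Definition orthogonalmx n (Q : 'M[R]_n) := Q^T *m Q == 1%:M.

Lemma orthogonalmxP n (Q : 'M[R]_n) : orthogonalmx Q -> Q^T *m Q = 1%:M /\ Q *m Q^T = 1%:M.
Proof. by move=> /eqP h; split=> //; apply: mulmx1C. Qed.

Lemma orthogonalmxM n (P Q : 'M[R]_n) : orthogonalmx P -> orthogonalmx Q -> orthogonalmx (P *m Q).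
Proof.
move=> /eqP hP /eqP hQ; apply/eqP.
by rewrite trmx_mul mulmxA -(mulmxA _ _ P) hP mulmx1 hQ.
Qed.

Lemma orthogonalmx_tr n (Q : 'M[R]_n) : orthogonalmx Q -> orthogonalmx Q^T.
Proof. by move=> /orthogonalmxP[_ h]; rewrite /orthogonalmx trmxK h. Qed.

Lemma orthogonalmx1 n : orthogonalmx (1%:M : 'M[R]_n).
Proof. by rewrite /orthogonalmx trmx1 mulmx1. Qed.

Lemma dot_orthogonalmx n (Q : 'M[R]_n) u v : orthogonalmx Q ->
  dot (Q *m u) (Q *m v) = dot u v.
Proof. by move=> /eqP h; rewrite dotMr mulmxA h mul1mx. Qed.

(** For u = 0 this is the identity, because 2 / 0 = 0; so it is orthogonal for
    every u. *)
Definition reflection n (u : 'cV[R]_n) : 'M[R]_n :=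
  1%:M - (2 / dot u u) *: (u *m u^T).

Lemma reflection_mul n (u v : 'cV[R]_n) : reflection u *m v = v - (2 * dot u v / dot u u) *: u.
Proof.
rewrite mulmxBl mul1mx -scalemxAl -mulmxA; congr (_ - _).
have -> : u^T *m v = (dot u v)%:M by rewrite [LHS]mx11_scalar.
by rewrite mul_mx_scalar scalerA mulrAC.
Qed.

Lemma tr_reflection n (u : 'cV[R]_n) : (reflection u)^T = reflection u.
Proof. by rewrite linearB /= linearZ /= trmx1 trmx_mul trmxK. Qed.

Lemma orthogonalmx_reflection n (u : 'cV[R]_n) : orthogonalmx (reflection u).
Proof.
rewrite /orthogonalmx tr_reflection; apply/eqP.
rewrite {2}/reflection mulmxBr mulmx1 -scalemxAr mulmxA reflection_mul.
have [->|u0] := eqVneq u 0.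
  by rewrite /reflection trmx0 !mulmx0 !scaler0 !subr0.
have up : dot u u != 0 by rewrite dot_eq0.
rewrite mulfK// scaler_nat mulr2n opprD addrA subrr sub0r mulNmx scalerN opprK.
by rewrite /reflection subrK.
Qed.

Lemma reflection_orth n (u v : 'cV[R]_n) : dot u v = 0 -> reflection u *m v = v.
Proof. by move=> h; rewrite reflection_mul h mulr0 mul0r scale0r subr0. Qed.

Lemma reflection_self n (u : 'cV[R]_n) : u != 0 -> reflection u *m u = - u.
Proof.
move=> u0; rewrite reflection_mul mulfK ?dot_eq0//.
by rewrite scaler_nat mulr2n opprD addrA subrr sub0r.
Qed.

Lemma reflection_swap n (x y : 'cV[R]_n) : dot x x = dot y y -> x != y ->
  reflection (x - y) *m x = y.
Proof.
move=> xy nxy; rewrite reflection_mul.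
have -> : dot (x - y) (x - y) = 2 * dot (x - y) x.
  by rewrite !(dotDr, dotDl, dotNr, dotNl) -xy (dotC y x); ring.
rewrite divff ?scale1r ?subKr//.
have : dot (x - y) (x - y) != 0 by rewrite dot_eq0 subr_eq0.
apply: contra_neq => h; rewrite !(dotDr, dotDl, dotNr, dotNl) -xy in h *.
by rewrite (dotC x y) opprK; lra.
Qed.

(** The reflection in u = x - y does this with e = 1; when x = y that vector
    vanishes, and u = x works with e = -1.  In both cases u lies in the span of
    x and y, so a vector orthogonal to both is fixed. *)
Lemma reflection_exists n (x y : 'cV[R]_n) : x != 0 -> dot x x = dot y y ->
  exists2 u, u != 0 & [/\ exists2 e, e ^+ 2 = 1 & reflection u *m x = e *: y &
    forall z, dot x z = 0 -> dot y z = 0 -> dot u z = 0].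
Proof.
move=> x0 xy; have [<-|nxy] := eqVneq x y.
  exists x => //; split=> //; exists (-1); rewrite ?sqrrN ?expr1n//.
  by rewrite reflection_self// scaleN1r.
exists (x - y); first by rewrite subr_eq0.
split=> [|z xz yz]; last by rewrite dotDl dotNl xz yz subr0.
by exists 1; rewrite ?expr1n// reflection_swap// scale1r.
Qed.

End Dot.

(** * The real spectral theorem *)

Section Spectral.
Context {R : realType}.

(** A complex eigenvector w = a + i b for z = x + i y satisfies A a = x a - y b
    and A b = x b + y a.  Symmetry makes a . A b and b . A a agree, which forces
    y (|a|^2 + |b|^2) = 0, so a and b are real eigenvectors or zero. *)
Lemma real_eigenvector n (A : 'M[R]_n.+1) : A^T = A ->
  exists x : R, exists2 v : 'cV[R]_n.+1, v != 0 & A *m v = x *: v.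
Proof.
move=> sA; pose f := (real_complex R).
have [z] := eigenvalue_closed (map_mx f A) isT.
case/eigenvalueP => w wA w0.
pose a : 'cV[R]_n.+1 := \col_i complex.Re (w 0 i).
pose b : 'cV[R]_n.+1 := \col_i complex.Im (w 0 i).
have h i : (A *m a) i 0 = complex.Re z * a i 0 - complex.Im z * b i 0 /\
           (A *m b) i 0 = complex.Re z * b i 0 + complex.Im z * a i 0.
  have := congr1 (fun M : 'rV_n.+1 => M 0 i) wA; rewrite !mxE => e.
  have -> : complex.Re z * complex.Re (w 0 i) - complex.Im z * complex.Im (w 0 i)
    = complex.Re (z * w 0 i) by case: (z) (w 0 i) => ? ? [].
  have -> : complex.Re z * complex.Im (w 0 i) + complex.Im z * complex.Re (w 0 i)
    = complex.Im (z * w 0 i) by case: (z) (w 0 i) => ? ? [].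
  rewrite -e !raddf_sum; split; apply: eq_bigr => j _;
    rewrite !mxE -{1}sA mxE; case: (w 0 j) => x y /=; simpc; by rewrite mulrC.
pose x := complex.Re z; pose y := complex.Im z.
have Aa : A *m a = x *: a - y *: b.
  by apply/colP => i; rewrite (h i).1 !mxE.
have Ab : A *m b = x *: b + y *: a.
  by apply/colP => i; rewrite (h i).2 !mxE.
have /eqP : y * (dot a a + dot b b) = 0.
  have := dotMr A b a; rewrite sA Aa Ab.
  by rewrite !(dotDr, dotDl, dotNr, dotNl, dotZr, dotZl) (dotC b a); lra.
have ab0 : ~~ ((a == 0) && (b == 0)).
  apply: contra w0 => /andP[/eqP/colP a0 /eqP/colP b0]; apply/eqP/rowP => i.
  by rewrite mxE; apply/eqP; have := a0 i; have := b0 i; rewrite !mxE eq_complex => -> -> /=; rewrite eqxx.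
rewrite mulf_eq0 => /orP[/eqP y0|]; last first.
  rewrite paddr_eq0 ?dot_ge0// !dot_eq0 => ab; by rewrite ab in ab0.
rewrite y0 !scale0r ?subr0 ?addr0 in Aa Ab; exists x.
by move: ab0; rewrite negb_and => /orP[]; [exists a|exists b].
Qed.

(** Induction on the size: a reflection carries the first coordinate axis to the
    line of an eigenvector, and in the new basis the matrix splits off a block of
    size one. *)
Lemma spectral n (A : 'M[R]_n) : A^T = A ->
  exists2 O : 'M[R]_n, orthogonalmx O & exists D, A = O *m diag_mx D *m O^T.
Proof.
elim: n A => [|n IH] A sA.
  exists 1%:M; [exact: orthogonalmx1|exists 0]; by apply/matrixP; case.
have [x [v v0 Av]] := real_eigenvector sA.
have vp : 0 < dot v v by rewrite dot_gt0.
pose e : 'cV[R]_n.+1 := delta_mx 0 0.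
pose c := Num.sqrt (dot v v).
have c0 : c != 0 by rewrite sqrtr_eq0 -ltNge.
have ce0 : c *: e != 0.
  rewrite scaler_eq0 (negbTE c0); apply/eqP => /colP/(_ 0).
  by rewrite !mxE eqxx => /eqP; rewrite oner_eq0.
have ee : dot e e = 1 by rewrite dot_delta mxE !eqxx.
have ve : dot (c *: e) (c *: e) = dot v v.
  by rewrite dotZl dotZr ee mulr1 -expr2 sqr_sqrtr// ltW.
have [u u0 [[s s2 Hs] _]] := reflection_exists ce0 ve.
pose H := reflection u; have [HtH HHt] := orthogonalmxP (orthogonalmx_reflection u).
rewrite -/H in HtH HHt Hs.
pose A' := (H^T *m A *m H : 'M[R]_(1 + n)).
have sA' : A'^T = A' by rewrite /A' !trmx_mul trmxK sA mulmxA.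
have A'e : A' *m e = x *: e.
  have sv : H^T *m (s *: v) = c *: e by rewrite -Hs mulmxA HtH mul1mx.
  apply: (scalerI c0); rewrite scalemxAr /A' -!mulmxA Hs -scalemxAr Av.
  by rewrite scalerA mulrC -scalerA -scalemxAr sv !scalerA mulrC.
have AE : A = H *m A' *m H^T.
  by rewrite /A' !mulmxA HHt mul1mx -!mulmxA HHt mulmx1.
clearbody A'.
have A'0 i : A' i 0 = x * (i == 0)%:R.
  have eE (j : 'I_(1 + n)) : e j 0 = (j == 0)%:R by rewrite mxE andbT.
  have := congr1 (fun M : 'cV_n.+1 => M i 0) A'e.
  rewrite [RHS]mxE [e i 0]eE => <-; rewrite [RHS]mxE (bigD1 0)//= eE eqxx mulr1.
  by rewrite big1 ?addr0// => j j0; rewrite eE (negbTE j0) mulr0.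
have [P oP [D' AD]] : exists2 O : 'M[R]_n, orthogonalmx O & exists D, drsubmx A' = O *m diag_mx D *m O^T.
  by apply: IH; rewrite trmx_drsub sA'.
have [PP _] := orthogonalmxP oP.
pose Q := (block_mx 1%:M 0 0 P : 'M[R]_(1 + n)).
have oQ : orthogonalmx Q.
  rewrite /orthogonalmx /Q tr_block_mx mulmx_block !trmx0 !trmx1.
  by rewrite !mulmx0 !mul0mx !mulmx1 !addr0 !add0r PP -scalar_mx_block.
exists (H *m Q : 'M[R]_n.+1); first by apply: orthogonalmxM; rewrite ?orthogonalmx_reflection.
exists (row_mx x%:M D' : 'rV[R]_(1 + n)).
rewrite AE trmx_mul -!mulmxA; congr (_ *m _); rewrite !mulmxA; congr (_ *m _).
rewrite -[LHS](submxK (A' : 'M[R]_(1 + n))).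
have e0 : lshift n (0 : 'I_1) = 0 by apply: val_inj.
have -> : ulsubmx A' = x%:M.
  by apply/matrixP => i j; rewrite !ord1 !mxE e0 A'0 !eqxx mulr1.
have dl : dlsubmx A' = 0.
  apply/matrixP => i j; rewrite !ord1 !mxE e0 A'0.
  by rewrite -val_eqE /= mulr0.
have -> : ursubmx A' = 0 by rewrite -[A']sA' -trmx_dlsub dl trmx0.
have dE : diag_mx (row_mx x%:M D' : 'rV[R]_(1 + n)) = block_mx x%:M 0 0 (diag_mx D').
  rewrite diag_mx_row; congr block_mx.
  by apply/matrixP => i j; rewrite !ord1 !mxE.
have QE : Q *m block_mx x%:M 0 0 (diag_mx D') *m Q^T =
    block_mx x%:M 0 0 (P *m diag_mx D' *m P^T).
  rewrite /Q tr_block_mx !mulmx_block !trmx0 trmx1.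
  by rewrite ?(mulmx0, mul0mx, mulmx1, mul1mx, addr0, add0r).
by rewrite dl [X in _ = _ *m X *m _^T]dE QE AD.
Qed.

Lemma spectral_sorted n (A : 'M[R]_n) : A^T = A ->
  exists2 O : 'M[R]_n, orthogonalmx O & exists2 D : 'rV[R]_n, A = O *m diag_mx D *m O^T &
    forall i j : 'I_n, (i <= j)%N -> D 0 j <= D 0 i.
Proof.
move=> /spectral[Q oQ [D AD]].
pose s := [tuple D 0 i | i < n].
pose t := sort_tuple >=%R s.
have [p tp] : exists p : {perm 'I_n}, t = [tuple tnth s (p i) | i < n] :> seq R.
  by apply/tuple_permP; rewrite perm_sort.
have tE i : tnth t i = D 0 (p i).
  have -> : t = [tuple tnth s (p i) | i < n] by apply: val_inj.
  by rewrite !tnth_mktuple.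
have pp : (perm_mx p)^T *m perm_mx p = 1%:M :> 'M[R]_n.
  by rewrite tr_perm_mx -perm_mxM mulVg perm_mx1.
exists (Q *m (perm_mx p)^T).
  apply: orthogonalmxM => //; apply: orthogonalmx_tr; exact/eqP.
exists (\row_i D 0 (p i)).
  rewrite trmx_mul trmxK AD !mulmxA; congr (_ *m _).
  rewrite -!mulmxA; congr (_ *m _).
  suff -> : diag_mx D = (perm_mx p)^T *m diag_mx (\row_i D 0 (p i)) *m perm_mx p.
    by rewrite mulmxA.
  rewrite tr_perm_mx -mulmxA -row_permE mul_diag_mx.
  by apply/matrixP => i j; rewrite !mxE permKV mulr_natr.
move=> i j ij; rewrite !mxE -!tE !(tnth_nth 0).
have : sorted >=%R t by apply: sort_sorted; exact: ge_total.
move=> /(sorted_leq_nth (@ge_trans _ _) (@ge_refl _ _) 0).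
move/(_ i j); apply=> //; rewrite inE size_tuple; exact: ltn_ord.
Qed.

Lemma dot_spectral n (O : 'M[R]_n) (D : 'rV[R]_n) v :
  dot v (O *m diag_mx D *m O^T *m v) = \sum_i D 0 i * (O^T *m v) i 0 ^+ 2.
Proof.
rewrite -!mulmxA dotMr dotE; apply: eq_bigr => i _.
by rewrite mul_diag_mx !mxE; ring.
Qed.

(** Diagonal entries are Rayleigh quotients of the columns; this is how bounds on
    the quadratic form become bounds on eigenvalues. *)
Lemma dot_spectral_col n (O : 'M[R]_n) (D : 'rV[R]_n) i : orthogonalmx O ->
  dot (col i O) (O *m diag_mx D *m O^T *m col i O) = D 0 i.
Proof.
move=> /orthogonalmxP[OO _]; rewrite dot_spectral (bigD1 i)//= !colE mulmxA OO mul1mx.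
rewrite mxE !eqxx expr1n mulr1 big1 ?addr0// => j ji.
by rewrite mxE (negbTE ji) expr0n mulr0.
Qed.

End Spectral.

(** * Singular values *)

Section SpectralSingularValues.
Context {R : realType}.

Lemma char_poly_orthogonal n (O : 'M[R]_n) (D : 'rV[R]_n) : orthogonalmx O ->
  char_poly (O *m diag_mx D *m O^T) = \prod_i ('X - (D 0 i)%:P).
Proof.
move=> /orthogonalmxP[_ OO]; pose f (M : 'M[R]_n) := map_mx (@polyC R) M.
have fM M N : f (M *m N) = f M *m f N by exact: map_mxM.
have fOO : f O *m f O^T = 1%:M by rewrite -fM OO; exact: map_mx1.
have -> : char_poly (O *m diag_mx D *m O^T) = char_poly (diag_mx D).
  rewrite /char_poly /char_poly_mx -!/(f _) !fM.
  have -> : 'X%:M - f O *m f (diag_mx D) *m f O^T =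
     f O *m ('X%:M - f (diag_mx D)) *m f O^T.
    rewrite mulmxBr mulmxBl mul_mx_scalar -scalemxAl fOO; congr (_ - _).
    by rewrite scalemx1.
  by rewrite !det_mulmx mulrAC -det_mulmx fOO det1 mul1r.
rewrite char_poly_trig; last exact: diag_mx_is_trig.
by apply: eq_bigr => i _; rewrite !mxE eqxx.
Qed.

Lemma count_flatten_nseq (T : eqType) (f : T -> nat) (l : seq T) x :
  count_mem x (flatten [seq nseq (f y) y | y <- l]) = (count_mem x l * f x)%N.
Proof.
elim: l => //= y l IH; rewrite count_cat IH count_nseq /= mulnDl; congr addn.
by case: eqP => // ->.
Qed.

(** For a split polynomial the distinct roots, repeated with multiplicity, give
    back the list of factors. *)
Lemma roots_with_multiplicity (s : seq R) p : p = \prod_(x <- s) ('X - x%:P) ->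
  perm_eq (flatten [seq nseq (mup x p) x | x <- rootsR p]) s.
Proof.
move=> pE; apply/allP => x _ /=; apply/eqP.
have pn0 : p != 0 by rewrite pE monic_neq0 ?monic_prod_XsubC.
have rp y : (y \in rootsR p) = (y \in s).
  rewrite -(roots_on_rootsR pn0) in_itv /= pE.
  by rewrite root_prod_XsubC.
rewrite count_flatten_nseq count_uniq_mem; last exact: uniq_roots.
rewrite rp pE mu_prod_XsubC; case: (boolP (x \in s)) => xs; rewrite ?mul1n// mul0n.
by apply/esym/count_memPn.
Qed.

(** By the spectral theorem the characteristic polynomial of A^T A splits with
    roots D 0 i, so the sorted list of their square roots is the list of
    singular values. *)
Lemma singular_values_spectral d (A : 'M[R]_d) : exists2 O : 'M[R]_d, orthogonalmx O &
  [/\ A^T *m A = O *m diag_mx (\row_i (singular_value A i.+1) ^+ 2) *m O^T,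
   forall i j : 'I_d, (i <= j)%N -> singular_value A j.+1 <= singular_value A i.+1 &
   forall i, 0 <= singular_value A i].
Proof.
have sA : (A^T *m A)^T = A^T *m A by rewrite trmx_mul trmxK.
have [Q oQ [D AD Dle]] := spectral_sorted sA.
exists Q => //.
have D0 i : 0 <= D 0 i.
  by rewrite -(dot_spectral_col D i oQ) -AD -mulmxA -dotMl dot_ge0.
have sE : singular_values A = [seq Num.sqrt (D 0 i) | i <- enum 'I_d].
  rewrite /singular_values AD char_poly_orthogonal//.
  apply: (sorted_eq (@ge_trans _ _)); first exact: ge_anti.
  - by apply: sort_sorted; exact: ge_total.
  - apply/(sortedP 0) => i; rewrite size_map size_enum_ord => id.
    have i1d := ltnW id.
    have e (k : 'I_d) : nth (Ordinal id) (enum 'I_d) k = k by rewrite nth_ord_enum.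
    rewrite !(nth_map (Ordinal id)) -?enumT ?size_enum_ord//.
    rewrite (e (Ordinal id)) (e (Ordinal i1d)).
    exact: (ler_wsqrtr (Dle (Ordinal i1d) (Ordinal id) _)).
  rewrite perm_sort map_comp; apply: perm_map.
  by apply: roots_with_multiplicity; rewrite big_map big_enum.
have vE (i : 'I_d) : singular_value A i.+1 = Num.sqrt (D 0 i).
  rewrite /singular_value sE succnK (nth_map i) ?size_enum_ord//.
  by rewrite nth_ord_enum.
split=> [|i j ij|i].
- rewrite AD; congr (_ *m diag_mx _ *m _); apply/rowP => i.
  by rewrite !mxE vE sqr_sqrtr.
- by rewrite !vE ler_wsqrtr// Dle.
rewrite /singular_value sE.
have [ic|ic] := ltnP i.-1 (size [seq Num.sqrt (D 0 i) | i <- enum 'I_d]); last by rewrite nth_default.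
by apply: (allP _ _ (mem_nth 0 ic)); apply/allP => x /mapP[j _ ->]; exact: sqrtr_ge0.
Qed.

End SpectralSingularValues.

(** * Orthogonal projections and the restricted map *)

Section Geometry.
Context {R : realType} {d : nat}.
Implicit Types (U V W E : {vspace 'cV[R]_d}) (B A O : 'M[R]_d) (u v x y : 'cV[R]_d).

(** Every dimension count below takes this form: fewer linear conditions than
    dimensions leave a nonzero solution. *)
Lemma kernel_vec E m (M : 'M[R]_(m, d)) : (m < \dim E)%N ->
  exists2 v, v \in E & v != 0 /\ M *m v = 0.
Proof.
move=> mE; pose f : 'Hom('cV[R]_d, 'cV[R]_m) := linfun (mulmx M).
have fm : (\dim (f @: E) <= m)%N.
  by rewrite (leq_trans (dimvS (subvf _)))// dimvf /dim /= muln1.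
have kp : (0 < \dim (E :&: lker f))%N.
  rewrite -(ltn_add2r (\dim (f @: E))) limg_ker_dim add0n.
  exact: leq_ltn_trans mE.
exists (vpick (E :&: lker f)%VS).
  by have := memv_pick (E :&: lker f)%VS; rewrite memv_cap => /andP[].
split; first by rewrite vpick0 -dimv_eq0 -lt0n.
have := memv_pick (E :&: lker f)%VS; rewrite memv_cap => /andP[_].
by rewrite memv_ker lfunE /= => /eqP.
Qed.

(** The conditions are the vanishing of the coordinates of M *m v in S. *)
Lemma kernel_coords E (M : 'M[R]_d) (S : pred 'I_d) : (#|S| < \dim E)%N ->
  exists2 v, v \in E & v != 0 /\ forall i, S i -> (M *m v) i 0 = 0.
Proof.
move=> /(kernel_vec (\matrix_(j < #|S|) row (enum_val j) M))[v vE [v0 Mv]].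
exists v => //; split=> // i Si; have := congr1 (row (enum_rank_in Si i)) Mv.
by rewrite row_mul rowK row0 enum_rankK_in// -row_mul => /colP/(_ 0); rewrite !mxE.
Qed.

Lemma dim_fullv : \dim (fullv : {vspace 'cV[R]_d}) = d.
Proof. by rewrite dimvf /dim /= muln1. Qed.

Lemma dimv_le U : (\dim U <= d)%N.
Proof. by have := dimvS (subvf U); rewrite dim_fullv. Qed.

Lemma dot_orthocompP U v : reflect (forall u, u \in U -> dot u v = 0) (v \in orthocomp U).
Proof.
apply: (iffP (orthocompP U v)) => h u uU; first by rewrite /dot h// mxE.
by apply/matrixP => i j; rewrite !ord1 -/(dot u v) h// mxE.
Qed.

Lemma proj_eq W v x : x \in W -> v - x \in orthocomp W -> proj W *m v = x.
Proof.
move=> xW vx; apply/eqP; rewrite -subr_eq0 -memv0 -(capv_orthocomp W) memv_cap.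
rewrite memvB ?proj_mem//=.
have -> : proj W *m v - x = (v - x) - (v - proj W *m v) by rewrite opprB [RHS]addrC subrKA.
by rewrite memvB// proj_orth.
Qed.

Lemma proj_id W v : v \in W -> proj W *m v = v.
Proof. by move=> vW; apply: proj_eq => //; rewrite subrr mem0v. Qed.

Lemma proj_orth0 W v : v \in orthocomp W -> proj W *m v = 0.
Proof. by move=> vW; apply: proj_eq; rewrite ?mem0v// subr0. Qed.

Lemma dot_proj W u v : u \in W -> dot u (proj W *m v) = dot u v.
Proof.
move=> uW; have /dot_orthocompP/(_ u uW) := proj_orth W v.
by rewrite dotDr dotNr => /eqP; rewrite subr_eq0 => /eqP.
Qed.

Lemma dot_proj2 W u v : dot (proj W *m u) (proj W *m v) = dot (proj W *m u) v.
Proof. by rewrite dot_proj// proj_mem. Qed.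

Lemma proj_sym W : (proj W)^T = proj W.
Proof.
apply/matrixP => i j; rewrite mxE.
have e k l : proj W k l = dot (proj W *m delta_mx l 0) (delta_mx k 0).
  by rewrite dotC dot_delta -colE [RHS]mxE.
by rewrite !e -dot_proj2 dotC dot_proj2.
Qed.

Lemma proj_idem W : proj W *m proj W = proj W.
Proof.
apply/matrixP => i j.
have e (M : 'M[R]_d) k l : M k l = (M *m delta_mx l (0 : 'I_1)) k 0.
  by rewrite -colE [RHS]mxE.
by rewrite e [RHS]e -mulmxA proj_id// proj_mem.
Qed.

Lemma dot_pythagoras W v :
  dot v v = dot (proj W *m v) (proj W *m v) +
            dot (v - proj W *m v) (v - proj W *m v).
Proof.
rewrite -dot_orth; first by rewrite addrC subrK.
by have /dot_orthocompP -> := proj_orth W v; rewrite ?proj_mem.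
Qed.

Lemma proj_contract W v : dot (proj W *m v) (proj W *m v) <= dot v v.
Proof. by rewrite [leRHS](dot_pythagoras W) lerDl dot_ge0. Qed.

Lemma dim_orthocomp W : (\dim (orthocomp W) = d - \dim W)%N.
Proof.
have := dimv_disjoint_sum (capv_orthocomp W).
by rewrite addv_orthocomp dim_fullv; lia.
Qed.

Lemma ominusP V U v : reflect (v \in V /\ forall u, u \in U -> dot u v = 0) (v \in ominus V U).
Proof.
by rewrite memv_cap; apply: (iffP andP) => -[? ?]; split=> //; apply/dot_orthocompP.
Qed.

Lemma dim_ominus V U : (U <= V)%VS -> \dim (ominus V U) = (\dim V - \dim U)%N.
Proof.
move=> UV; have dU := dimv_le U.
apply/eqP; rewrite eqn_leq; apply/andP; split.
  rewrite leq_subRL ?dimvS// -dimv_disjoint_sum; last first.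
    apply/eqP; rewrite -subv0 -(capv_orthocomp U) capvS//.
    exact: capvSr.
  by apply: dimvS; rewrite subv_add UV capvSl.
have := dimv_sum_cap V (orthocomp U).
have := dimv_le (V + orthocomp U)%VS.
rewrite dim_orthocomp -/(ominus V U); have := dimvS UV; lia.
Qed.

Lemma mem_mximg B V v : v \in V -> B *m v \in mximg B V.
Proof. by move=> vV; apply/memv_imgP; exists v; rewrite ?lfunE. Qed.

Lemma mximgP B V y : y \in mximg B V -> exists2 v, v \in V & y = B *m v.
Proof. by case/memv_imgP => v vV ->; exists v; rewrite ?lfunE. Qed.

Section Restr.
Variables (B : 'M[R]_d) (V U : {vspace 'cV[R]_d}).
Hypothesis UV : (U <= V)%VS.
Local Notation A := (mxrestr B V U).

Lemma restr_proj x : A *m (proj (ominus V U) *m x) = A *m x.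
Proof. by rewrite /mxrestr -!mulmxA [X in _ *m (_ *m X)]mulmxA proj_idem. Qed.

Lemma restr_orth x : x \in orthocomp (ominus V U) -> A *m x = 0.
Proof. by move=> h; rewrite -restr_proj proj_orth0// mulmx0. Qed.

Lemma restr_img_orth u : u \in U ->
  proj (ominus (mximg B V) (mximg B U)) *m (B *m u) = 0.
Proof.
move=> uU; apply: proj_orth0; apply/dot_orthocompP => y /ominusP[_ h].
by rewrite dotC h// mem_mximg.
Qed.

(** A v is the component of B v orthogonal to B U, that is B v - B u, where B u is
    the projection of B v to B U. *)
Lemma restr_eq v : v \in ominus V U -> exists2 u, u \in U & A *m v = B *m (v - u).
Proof.
move=> vVU; have [vV _] := ominusP _ _ _ vVU.
have [u uU pE] := mximgP (proj_mem (mximg B U) (B *m v)).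
exists u => //; rewrite /mxrestr -mulmxA proj_id// -mulmxA.
apply: proj_eq.
  apply/ominusP; split.
    by apply: mem_mximg; rewrite memvB// (subvP UV).
  by move=> y yU; rewrite mulmxBr -pE; move/dot_orthocompP: (proj_orth (mximg B U) (B *m v)); apply.
rewrite mulmxBr opprB addrC subrK; apply/dot_orthocompP => y /ominusP[_ h].
by rewrite dotC h// mem_mximg.
Qed.

(** Subtracting u in U does not change the component orthogonal to B U, and
    projections do not increase lengths. *)
Lemma restr_le v u : v \in ominus V U -> u \in U ->
  dot (A *m v) (A *m v) <= dot (B *m (v - u)) (B *m (v - u)).
Proof.
move=> vVU uU; have -> : A *m v = proj (ominus (mximg B V) (mximg B U)) *m (B *m (v - u)).
  by rewrite !mulmxBr (restr_img_orth uU) subr0 /mxrestr -!mulmxA (proj_id vVU).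
exact: proj_contract.
Qed.

End Restr.

End Geometry.

(** * Minimax bounds for singular values *)

Section Minimax.
Context {R : realType} {d : nat}.
Implicit Types (U V W E : {vspace 'cV[R]_d}) (B A O : 'M[R]_d) (u v x y : 'cV[R]_d).

(** The columns of O are right singular vectors of A, listed in the order of the
    decreasing singular values. *)
Definition singular_basis O A := [/\ orthogonalmx O,
  A^T *m A = O *m diag_mx (\row_i (singular_value A i.+1) ^+ 2) *m O^T,
  forall i j : 'I_d, (i <= j)%N -> singular_value A j.+1 <= singular_value A i.+1 &
  forall i, 0 <= singular_value A i].

Lemma singular_basis_exists A : exists O, singular_basis O A.
Proof. by have [ O oO [h1 h2 h3]] := singular_values_spectral A; exists O. Qed.

Lemma dot_coords O v : orthogonalmx O -> dot v v = \sum_i (O^T *m v) i 0 ^+ 2.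
Proof.
move=> oO; rewrite -(dot_orthogonalmx _ _ (orthogonalmx_tr oO)) dotE.
by apply: eq_bigr => i _; rewrite expr2.
Qed.

Lemma dot_mul_singular_basis O A v : singular_basis O A ->
  dot (A *m v) (A *m v) = \sum_(i < d) singular_value A i.+1 ^+ 2 * (O^T *m v) i 0 ^+ 2.
Proof.
move=> [ oO AA _ _]; rewrite dotMl mulmxA AA dot_spectral.
by apply: eq_bigr => i _; rewrite mxE.
Qed.

Lemma dot_mul_low_le O A v (i : 'I_d) : singular_basis O A ->
  (forall j : 'I_d, (j < i)%N -> (O^T *m v) j 0 = 0) ->
  dot (A *m v) (A *m v) <= singular_value A i.+1 ^+ 2 * dot v v.
Proof.
move=> svdA v0; have [ oO _ s_dec s_ge0] := svdA.
rewrite (dot_mul_singular_basis v svdA) (dot_coords v oO) mulr_sumr; apply: ler_sum => j _.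
have [ji|ij] := ltnP j i; first by rewrite v0// expr0n !mulr0.
by rewrite ler_wpM2r ?sqr_ge0// ler_pXn2r ?nnegrE ?s_ge0// s_dec.
Qed.

Lemma dot_mul_top_ge O A v (i : 'I_d) : singular_basis O A ->
  (forall j : 'I_d, (i < j)%N -> (O^T *m v) j 0 = 0) ->
  singular_value A i.+1 ^+ 2 * dot v v <= dot (A *m v) (A *m v).
Proof.
move=> svdA v0; have [ oO _ s_dec s_ge0] := svdA.
rewrite (dot_mul_singular_basis v svdA) (dot_coords v oO) mulr_sumr; apply: ler_sum => j _.
have [ij|ji] := ltnP i j; first by rewrite v0// expr0n !mulr0.
by rewrite ler_wpM2r ?sqr_ge0// ler_pXn2r ?nnegrE ?s_ge0// s_dec.
Qed.

Lemma card_ord_ltn i : (i <= d)%N -> #|[pred j : 'I_d | (j < i)%N]| = i.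
Proof.
move=> id; rewrite -sum1_card; rewrite (eq_bigl (fun j : 'I_d => (j < i)%N))//.
by rewrite -(big_ord_widen d (fun=> 1%N) id) sum1_card card_ord.
Qed.

Lemma card_ord_geq i : (i <= d)%N -> #|[pred j : 'I_d | (i <= j)%N]| = (d - i)%N.
Proof.
move=> id; apply: (@addnI i); rewrite subnKC//.
have := cardC [pred j : 'I_d | (j < i)%N]; rewrite card_ord_ltn// card_ord.
apply: etrans; congr addn; apply: eq_card => j.
by rewrite !inE -leqNgt.
Qed.

(** The directions with singular value at most the i-th are cut out by i linear
    conditions, so a subspace of dimension above i contains one of them.  The
    index i starts at 0 and singular values are counted from 1. *)
Lemma singular_value_ge A E c (i : 'I_d) : (i < \dim E)%N ->
  (forall v, v \in E -> c * dot v v <= dot (A *m v) (A *m v)) ->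
  c <= singular_value A i.+1 ^+ 2.
Proof.
move=> iE h; have [ O svdA] := singular_basis_exists A.
have [|v vE [v0 Ov]] := @kernel_coords _ _ E O^T [pred j : 'I_d | (j < i)%N].
  by rewrite card_ord_ltn// ltnW.
have := le_trans (h v vE) (dot_mul_low_le svdA Ov).
by rewrite ler_pM2r// dot_gt0.
Qed.

(** Dually, the span of the first i + 1 singular directions is cut out by
    d - (i + 1) conditions and meets E. *)
Lemma singular_value_le A E c (i : 'I_d) : (d - i.+1 < \dim E)%N ->
  (forall v, v \in E -> dot (A *m v) (A *m v) <= c * dot v v) ->
  singular_value A i.+1 ^+ 2 <= c.
Proof.
move=> iE h; have [ O svdA] := singular_basis_exists A.
have [|v vE [v0 Ov]] := @kernel_coords _ _ E O^T [pred j : 'I_d | (i.+1 <= j)%N].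
  by rewrite card_ord_geq.
have := le_trans (dot_mul_top_ge svdA Ov) (h v vE).
by rewrite ler_pM2r// dot_gt0.
Qed.

(** The orthogonal projection to the span of the first m columns of O, when O is
    orthogonal. *)
Definition cproj O m : 'M[R]_d := O *m pid_mx m *m O^T.

Lemma cproj_coord O m v i : orthogonalmx O ->
  (O^T *m (cproj O m *m v)) i 0 = (O^T *m v) i 0 *+ (i < m)%N.
Proof.
move=> /orthogonalmxP[OO _]; rewrite /cproj !mulmxA OO mul1mx -mulmxA.
rewrite mxE (bigD1 i)//= big1 => [|j ji].
  by rewrite [pid_mx _ _ _]mxE eqxx /= addr0 mulr_natl.
by rewrite [pid_mx _ _ _]mxE eq_sym (inj_eq val_inj) (negbTE ji) mul0r.
Qed.

Lemma cproj_sym O m : (cproj O m)^T = cproj O m.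
Proof. by rewrite /cproj !trmx_mul trmxK tr_pid_mx mulmxA. Qed.

Lemma cproj_idem O m : orthogonalmx O -> cproj O m *m cproj O m = cproj O m.
Proof.
move=> /orthogonalmxP[OO _]; rewrite /cproj !mulmxA -(mulmxA _ O^T) OO mulmx1.
by rewrite -(mulmxA O) mul_pid_mx minnn pid_mx_minv.
Qed.

Lemma cproj0 O m v : orthogonalmx O ->
  (forall i : 'I_d, (i < m)%N -> (O^T *m v) i 0 = 0) -> cproj O m *m v = 0.
Proof.
move=> oO h; have [_ OO] := orthogonalmxP oO.
rewrite -[LHS]mul1mx -OO -mulmxA; suff -> : O^T *m (cproj O m *m v) = 0 by rewrite mulmx0.
by apply/colP => i; rewrite cproj_coord// [RHS]mxE; case: ltnP => // im; rewrite h.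
Qed.

Lemma cproj_id O m v : orthogonalmx O ->
  (forall i : 'I_d, (m <= i)%N -> (O^T *m v) i 0 = 0) -> cproj O m *m v = v.
Proof.
move=> oO h; have [_ OO] := orthogonalmxP oO.
rewrite -[LHS]mul1mx -[RHS]mul1mx -OO -[LHS]mulmxA -[RHS]mulmxA; congr (_ *m _).
by apply/colP => i; rewrite cproj_coord//; case: ltnP => // mi; rewrite h.
Qed.

(** The constant c bounds from below the squared cosine of the largest angle
    between V and the span of the first m columns of O. *)
Definition transverse O m V c := forall v, v \in V ->
  c * dot v v <= dot (cproj O m *m v) (cproj O m *m v).

(** Transversality makes the projection injective on V, hence onto its range by
    equality of dimensions: in V + <[x]> some nonzero combination of x and a
    vector of V has zero projection, and x must occur in it. *)
Lemma transverse_onto O m V c x : orthogonalmx O -> \dim V = m -> 0 < c -> transverse O m V c ->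
  exists2 u, u \in V & cproj O m *m (x - u) = 0.
Proof.
move=> oO dV c0 tV; have [xV|xV] := boolP (x \in V).
  by exists x => //; rewrite subrr mulmx0.
have [|w] := @kernel_coords _ _ (V + <[x]>)%VS O^T [pred j : 'I_d | (j < m)%N].
  rewrite card_ord_ltn -?dV ?dimv_le// ltnNge; apply: contra xV => h.
  have /eqP -> : (V == V + <[x]>)%VS by rewrite eqEdim addvSl.
  by rewrite memvE addvSr.
move=> /memv_addP[v vV [_ /vlineP[t ->] ->]] [w0 /(cproj0 oO) Pw].
have t0 : t != 0.
  apply: contra_neq w0 => t0; move: Pw; rewrite t0 scale0r addr0 => Pv.
  apply/eqP; rewrite -dot_eq0; have := tV v vV; rewrite Pv dot0r.
  by rewrite pmulr_rle0// => vle0; rewrite eq_le vle0 dot_ge0.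
exists (- t^-1 *: v); first by rewrite memvZ.
apply: (scalerI t0); rewrite scaler0 scalemxAr scaleNr opprK scalerDr.
by rewrite scalerA divff// scale1r addrC.
Qed.

(** The angle condition is symmetric in the two m-dimensional subspaces: writing
    z as the projection of x in V, one has x . z = |z|^2, and Cauchy-Schwarz for
    x and the projection of z to V gives the bound. *)
Lemma transverse_dual O m V c z : orthogonalmx O -> \dim V = m -> 0 < c -> transverse O m V c ->
  cproj O m *m z = z -> c * dot z z <= dot (proj V *m z) (proj V *m z).
Proof.
move=> oO dV c0 tV Pz; have [x xV] := transverse_onto z oO dV c0 tV.
rewrite mulmxBr Pz => /eqP; rewrite subr_eq0 => /eqP zE.
have e : dot x z = dot z z.
  by rewrite {2}zE dotMl cproj_sym Pz.
have h1 := cauchy_schwarz x (proj V *m z).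
rewrite dot_proj// e in h1.
have := tV x xV; rewrite -zE => h2.
have [->|z0] := eqVneq z 0; first by rewrite mulmx0 !dot0r mulr0.
have zp : 0 < dot z z by rewrite dot_gt0.
set p := dot (proj V *m z) _ in h1 *; set q := dot x x in h1 h2; set r := dot z z in h1 h2 zp *.
have p0 : 0 <= p by exact: dot_ge0.
rewrite -(ler_pM2r zp); nra.
Qed.

End Minimax.

(** * Comparison of the singular values of the restricted map with those of B *)

Section Estimate.
Context {R : realType} {d : nat}.
Variables (B O : 'M[R]_d) (U V : {vspace 'cV[R]_d}) (m : nat) (a b : R).
Hypotheses (Bu : B \in unitmx) (svdB : singular_basis O B) (UV : (U <= V)%VS).
Hypotheses (dU : \dim U = m) (dV : \dim V = m.+2) (a0 : 0 < a) (b0 : 0 < b).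
Hypotheses (tU : transverse O m U a) (tV : transverse O m.+2 V b).
Local Notation A := (mxrestr B V U).
Local Notation sA := (singular_value A).
Local Notation sB := (singular_value B).

Let oO : orthogonalmx O. Proof. by case: svdB. Qed.
Let md : (m.+2 <= d)%N. Proof. by rewrite -dV dimv_le. Qed.
Let i0 : 'I_d := Ordinal (leq_trans (ltn0Sn _) md).
Let i1 : 'I_d := Ordinal (leq_trans (isT : (1 < m.+2)%N) md).
Let im : 'I_d := Ordinal (leq_trans (leqnSn _) md).
Let im1 : 'I_d := Ordinal md.

Let cproj_contract n (v : 'cV[R]_d) : dot (cproj O n *m v) (cproj O n *m v) <= dot v v.
Proof.
rewrite !(dot_coords _ oO); apply: ler_sum => i _.
by rewrite cproj_coord//; case: ltnP; rewrite // mulr0n expr0n sqr_ge0.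
Qed.

(** If v - u has zero projection, then u and v have the same projection, so
    transversality of U bounds |u| in terms of |v|. *)
Let residual_le (u v : 'cV[R]_d) : u \in U -> (forall w, w \in U -> dot w v = 0) -> cproj O m *m (v - u) = 0 ->
  dot (v - u) (v - u) <= (1 + a^-1) * dot v v.
Proof.
move=> uU vU Pvu; rewrite dot_orth ?dotNr ?dotNl ?opprK; last first.
  by rewrite dotC vU// oppr0.
rewrite mulrDl mul1r lerD2l ler_pdivlMl// (le_trans (tU uU))//.
move: Pvu; rewrite mulmxBr => /eqP; rewrite subr_eq0 => /eqP <-.
exact: cproj_contract.
Qed.

Let c0 : 0 <= 1 + a^-1. Proof. by rewrite addr_ge0// invr_ge0 ltW. Qed.

Let cproj_eq0 n (v : 'cV[R]_d) : cproj O n *m v = 0 -> forall j : 'I_d, (j < n)%N -> (O^T *m v) j 0 = 0.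
Proof. by move=> Pv j jn; have := cproj_coord n v j oO; rewrite Pv mulmx0 mxE jn. Qed.

(** For v orthogonal to U choose u in U such that v - u has no component along the
    first m singular directions; then B stretches v - u by at most the next
    singular value. *)
Lemma restr_singular1_le : sA 1 ^+ 2 <= (1 + a^-1) * sB m.+1 ^+ 2.
Proof.
apply: (@singular_value_le _ _ A fullv _ i0) => [|x _].
  by rewrite dim_fullv subn1 prednK// (leq_trans _ md).
rewrite -restr_proj; set v := proj _ *m x.
have vVU : v \in ominus V U by exact: proj_mem.
have [vV vU] := ominusP _ _ _ vVU.
have [u uU Pvu] := transverse_onto v oO dU a0 tU.
apply: le_trans (restr_le B vVU uU) _.
apply: le_trans (dot_mul_low_le (i := im) svdB (cproj_eq0 Pvu)) _.
rewrite [leRHS]mulrAC [leRHS]mulrC ler_wpM2l ?sqr_ge0//.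
apply: le_trans (residual_le uU vU Pvu) _; rewrite ler_wpM2l//.
exact: proj_contract.
Qed.

(** For every x, |B x| is at least s_(m+2)(B) times the length of the projection of
    x to the first m + 2 singular directions.  Apply this to x = v - u, which lies
    in V and is not shorter than v. *)
Lemma restr_singular2_ge : b * sB m.+2 ^+ 2 <= sA 2 ^+ 2.
Proof.
apply: (@singular_value_ge _ _ A (ominus V U) _ i1) => [|v vVU].
  by rewrite dim_ominus// dU dV /=; lia.
have [vV vU] := ominusP _ _ _ vVU.
have [u uU ->] := restr_eq B UV vVU.
have vuV : v - u \in V by rewrite memvB// (subvP UV).
have h0 : dot v v <= dot (v - u) (v - u).
  rewrite [leRHS]dot_orth ?lerDl ?dot_ge0//.
  by rewrite dotNr dotC vU// oppr0.
have h1 := tV vuV.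
have h2 : sB m.+2 ^+ 2 * dot (cproj O m.+2 *m (v - u)) (cproj O m.+2 *m (v - u)) <=
   dot (B *m (v - u)) (B *m (v - u)).
  have [_ _ s_dec s_ge0] := svdB.
  rewrite (dot_mul_singular_basis _ svdB) (dot_coords _ oO) mulr_sumr; apply: ler_sum => j _.
  rewrite cproj_coord//; case: ltnP => jm.
    by rewrite mulr1n ler_wpM2r ?sqr_ge0// ler_pXn2r ?nnegrE ?s_ge0// (s_dec j im1).
  by rewrite mulr0n expr0n mulr0 mulr_ge0 ?sqr_ge0.
apply: le_trans h2; rewrite [leLHS]mulrAC [leLHS]mulrC ler_wpM2l ?sqr_ge0//.
by apply: le_trans h1; rewrite ler_wpM2l// ltW.
Qed.

(** V has dimension m + 2, so it contains a nonzero v without component along the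
    first m + 1 singular directions.  Its component v' orthogonal to U is not
    much shorter, and A is small on v' and vanishes on the complement of the
    two-dimensional domain. *)
Lemma restr_singular2_le : sA 2 ^+ 2 <= (1 + a^-1) * sB m.+2 ^+ 2.
Proof.
have [|v vV [v0 Ov]] := @kernel_coords _ _ V O^T [pred j : 'I_d | (j < m.+1)%N].
  by rewrite card_ord_ltn ?dV// ltnW.
pose v' := v - proj U *m v.
have uU : proj U *m v \in U by exact: proj_mem.
have v'VU : v' \in ominus V U.
  apply/ominusP; split; first by rewrite memvB// (subvP UV).
  exact: (elimT (dot_orthocompP _ _) (proj_orth _ _)).
have [v'V v'U] := ominusP _ _ _ v'VU.
have vE : v = v' - - (proj U *m v) by rewrite opprK subrK.
have nv : dot v v <= (1 + a^-1) * dot v' v'.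
  rewrite {1 2}vE; apply: residual_le => //; first by rewrite memvN.
  by rewrite -vE; apply: cproj0 => // j jm; apply: Ov; exact: ltnW.
have Av' : dot (A *m v') (A *m v') <= (1 + a^-1) * sB m.+2 ^+ 2 * dot v' v'.
  apply: (le_trans (@restr_le _ _ B V U v' (- (proj U *m v)) v'VU _)); first by rewrite memvN.
  rewrite -vE; apply: le_trans (dot_mul_low_le (i := im1) svdB Ov) _.
  by rewrite [leRHS]mulrAC [leRHS]mulrC ler_wpM2l ?sqr_ge0.
have v'0 : v' != 0.
  apply: contra_neq v0 => v'0; apply/eqP; move: nv.
  by rewrite v'0 dot0r mulr0 -dot_eq0 => h; rewrite eq_le h dot_ge0.
apply: (@singular_value_le _ _ A (orthocomp (ominus V U) + <[v']>)%VS _ i1) => [|x].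
  rewrite dimv_disjoint_sum; last first.
    apply/eqP; rewrite -subv0 -(capv_orthocomp (ominus V U)) [X in (X <= _)%VS]capvC.
    by apply: capvS => //; rewrite -memvE.
  rewrite dim_orthocomp dim_ominus// dU dV dim_vline v'0.
  by rewrite (_ : (m.+2 - m)%N = 2)%N ?addn1 ?ltnSn// -[m.+2]addn2 addKn.
move=> /memv_addP[w wE [_ /vlineP[t ->] ->]].
rewrite mulmxDr (restr_orth _ wE) add0r -scalemxAr dotZl dotZr mulrA -expr2.
have wv' : dot w (t *: v') = 0 by move/dot_orthocompP: wE => /(_ _ v'VU); rewrite dotZr dotC => ->; rewrite mulr0.
rewrite (dot_orth wv') dotZl dotZr mulrA -expr2.
rewrite (le_trans (ler_wpM2l (sqr_ge0 t) Av'))// mulrCA ler_wpM2l ?lerDr ?dot_ge0//.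
by rewrite mulr_ge0 ?sqr_ge0.
Qed.

(** Choose w in the span of the first m + 1 singular directions such that
    z = B^T B w is orthogonal to U, and put y = B w.  For v the projection of z
    to V, the inner product of y with B (v - u) equals |v|^2 for every u in U, so
    |B (v - u)| >= |v|^2 / |y|; here |y| is at most |z| / s_(m+1)(B), and |v| is
    comparable with |z| by transverse_dual. *)
Lemma restr_singular1_ge : b * sB m.+1 ^+ 2 <= sA 1 ^+ 2.
Proof.
have [|w wE [w0 Ow]] := @kernel_coords _ _ (orthocomp (mximg (B^T *m B) U))
    O^T [pred j : 'I_d | (m.+1 <= j)%N].
  rewrite card_ord_geq ?(ltnW md)// dim_orthocomp.
  have : (\dim (mximg (B^T *m B) U) <= m)%N.
    by rewrite -dU -(limg_ker_dim (linfun (mulmx (B^T *m B))) U) leq_addl.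
  by have := md; lia.
have wU u : u \in U -> dot u (B^T *m B *m w) = 0.
  move=> uU; rewrite dotMr trmx_mul trmxK.
  by move/dot_orthocompP: wE; apply; exact: mem_mximg.
pose z := B^T *m B *m w; pose y := B *m w.
have Bw0 : 0 < dot y y.
  rewrite dot_gt0; apply: contra_neq w0 => /(congr1 (mulmx (invmx B))).
  by rewrite mulKmx// mulmx0.
have yz : dot w z = dot y y by rewrite /z -mulmxA -dotMl.
have zO (j : 'I_d) : (O^T *m z) j 0 = sB j.+1 ^+ 2 * (O^T *m w) j 0.
  have [_ BB _ _] := svdB; have [OO _] := orthogonalmxP oO.
  rewrite /z BB !mulmxA OO mul1mx -mulmxA mul_diag_mx !mxE //.
have zz : sB m.+1 ^+ 2 * dot y y <= dot z z.
  have [_ _ s_dec s_ge0] := svdB.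
  rewrite (dot_mul_singular_basis _ svdB) (dot_coords z oO) mulr_sumr; apply: ler_sum => j _.
  rewrite zO; have [jm|mj] := ltnP j m.+1; last by rewrite Ow// expr0n !mulr0 expr0n.
  have sjm : sB m.+1 ^+ 2 <= sB j.+1 ^+ 2.
    by rewrite ler_pXn2r ?nnegrE ?s_ge0// (s_dec j im).
  set q := sB j.+1 ^+ 2 in sjm *; set x := (O^T *m w) j 0.
  have -> : (q * x) ^+ 2 = q * (q * x ^+ 2) by ring.
  by rewrite ler_wpM2r// mulr_ge0 ?sqr_ge0.
have Pz : cproj O m.+2 *m z = z.
  by apply: cproj_id => // j mj; rewrite zO (Ow j (ltnW mj)) mulr0.
have vz := transverse_dual oO dV b0 tV Pz.
pose v := proj V *m z.
have vV : v \in V by exact: proj_mem.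
have vVU : v \in ominus V U.
  by apply/ominusP; split=> // u uU; rewrite dot_proj ?wU// (subvP UV).
have zp : 0 < dot z z.
  rewrite dot_gt0; apply: contra_neq w0 => z0.
  by move: Bw0; rewrite -yz z0 dot0r ltxx.
have vp : 0 < dot v v by apply: lt_le_trans vz; rewrite mulr_gt0.
apply: (@singular_value_ge _ _ A <[v]>%VS _ i0) => [|_ /vlineP[t ->]].
  by rewrite dim_vline -dot_gt0 vp.
rewrite -scalemxAr !dotZl !dotZr.
suff h : b * sB m.+1 ^+ 2 * dot v v <= dot (A *m v) (A *m v).
  have -> : b * sB m.+1 ^+ 2 * (t * (t * dot v v)) =
    t ^+ 2 * (b * sB m.+1 ^+ 2 * dot v v) by ring.
  by rewrite mulrA -expr2 ler_wpM2l ?sqr_ge0.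
have [u uU ->] := restr_eq B UV vVU.
have yv : dot y (B *m (v - u)) = dot v v.
  rewrite /y dotMr mulmxA -/z dotDr dotNr (dotC z u) wU// subr0.
  by rewrite dotC /v dot_proj2.
have := cauchy_schwarz y (B *m (v - u)); rewrite yv => h.
set q := dot (B *m _) _ in h *.
rewrite -(ler_pM2l Bw0); apply: le_trans h; rewrite expr2.
rewrite [leLHS]mulrA ler_pM2r//; apply: le_trans vz.
by rewrite mulrCA (mulrC (dot y y)) ler_wpM2l// ltW.
Qed.

Lemma singular_value_gt0 (i : 'I_d) : 0 < sB i.+1.
Proof.
have [_ BB _ s_ge0] := svdB; have [OO _] := orthogonalmxP oO.
rewrite lt_def s_ge0 andbT; apply/eqP => s0.
have Oi : col i O != 0.
  rewrite -dot_eq0 dot_col OO mxE eqxx; exact: oner_neq0.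
have : dot (B *m col i O) (B *m col i O) = 0.
  by rewrite dotMl mulmxA BB dot_spectral_col// mxE s0 expr0n.
move=> /eqP; rewrite dot_eq0 => /eqP /(congr1 (mulmx (invmx B))).
by rewrite mulKmx// mulmx0 => /eqP; rewrite (negbTE Oi).
Qed.

(** The square of the ratio of singular values is changed by a factor between
    b / (1 + 1/a) and its inverse, and (1 + 1/a) / b <= 2 / (a b). *)
Lemma ln_ratio_close : a <= 1 -> b <= 1 ->
  `| ln (sA 1 / sA 2) - ln (sB m.+1 / sB m.+2) | <= ln 2 - ln a - ln b.
Proof.
move=> a1 b1.
have sB1 : 0 < sB m.+1 := singular_value_gt0 im.
have sB2 : 0 < sB m.+2 := singular_value_gt0 im1.
have e1 := restr_singular1_le; have e2 := restr_singular2_ge; have e3 := restr_singular2_le; have e4 := restr_singular1_ge.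
have sA_ge0 i : 0 <= sA i by have [? [_ _ _ ->]] := singular_basis_exists A.
have sA1 : 0 < sA 1.
  rewrite lt_def sA_ge0 andbT -sqrf_eq0 gt_eqF//.
  by apply: lt_le_trans e4; rewrite mulr_gt0// exprn_gt0.
have sA2 : 0 < sA 2.
  rewrite lt_def sA_ge0 andbT -sqrf_eq0 gt_eqF//.
  by apply: lt_le_trans e2; rewrite mulr_gt0// exprn_gt0.
have lnsq (x : R) : 0 < x -> ln (x ^+ 2) = 2 * ln x.
  by move=> x0; rewrite lnXn// mulr_natl.
have lnm (x y : R) : 0 < x -> 0 < y -> ln (x * y) = ln x + ln y.
  by move=> x0 y0; rewrite lnM ?posrE.
have c1 : 0 < 1 + a^-1 by rewrite addr_gt0// invr_gt0.
have lnle (x y : R) : 0 < x -> x <= y -> ln x <= ln y.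
  by move=> x0 xy; rewrite ler_ln ?posrE// (lt_le_trans x0).
have lnc : ln (1 + a^-1) <= ln 2 - ln a.
  rewrite -lnV ?posrE// -lnM ?posrE ?invr_gt0//; apply: lnle => //.
  by rewrite mulr_natl mulr2n lerD2r invf_ge1.
have lna : ln a <= 0 by exact: ln_le0.
have lnb : ln b <= 0 by exact: ln_le0.
have ln2 : 0 <= ln (2 : R) by rewrite ln_ge0// ler1n.
have B1p : 0 < sB m.+1 ^+ 2 by rewrite exprn_gt0.
have B2p : 0 < sB m.+2 ^+ 2 by rewrite exprn_gt0.
have A1p : 0 < sA 1 ^+ 2 by rewrite exprn_gt0.
have A2p : 0 < sA 2 ^+ 2 by rewrite exprn_gt0.
have := lnle _ _ A1p e1; rewrite (lnm _ _ c1 B1p) !lnsq// => f1.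
have := lnle _ _ (mulr_gt0 b0 B2p) e2; rewrite (lnm _ _ b0 B2p) !lnsq// => f2.
have := lnle _ _ A2p e3; rewrite (lnm _ _ c1 B2p) !lnsq// => f3.
have := lnle _ _ (mulr_gt0 b0 B1p) e4; rewrite (lnm _ _ b0 B1p) !lnsq// => f4.
rewrite !ln_div ?posrE// ler_norml; apply/andP; split; lra.
Qed.

End Estimate.

(** * The overlap determinant *)

Section Overlap.
Context {R : realType} {d : nat}.
Implicit Types (V : {vspace 'cV[R]_d}) (M P : 'M[R]_d).

(** The determinant of the compression of M to the range of P: the summand
    1%:M - P fills the complement of that range with the identity.  As P ranges
    over the projections, this is polynomial in the entries of P. *)
Definition overlap M P : R := \det (1%:M - P + P *m M *m P).

(** The matrix G = 1 - P + P M P is symmetric with eigenvalues in [0, 1], so its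
    determinant is at most each of its eigenvalues.  On the range of P the
    quadratic form of G is that of M. *)
Lemma overlap_bound M P v : P^T = P -> P *m P = P -> M^T = M -> M *m M = M ->
  [/\ 0 <= overlap M P, overlap M P <= 1 &
   P *m v = v -> overlap M P * dot v v <= dot (M *m v) (M *m v)].
Proof.
move=> sP PP sM MM; pose G := 1%:M - P + P *m M *m P.
have sG : G^T = G.
  by rewrite /G linearD linearB /= trmx1 !trmx_mul sP sM mulmxA.
have quadP (x : 'cV[R]_d) : dot x (P *m x) = dot (P *m x) (P *m x).
  by rewrite dotMl sP mulmxA PP.
have quadM (x : 'cV[R]_d) : dot x (M *m x) = dot (M *m x) (M *m x).
  by rewrite dotMl sM mulmxA MM.
have quadG x : dot x (G *m x) = dot x x - dot (P *m x) (P *m x) + dot (M *m (P *m x)) (M *m (P *m x)).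
  rewrite /G mulmxDl mulmxBl mul1mx dotDr dotDr dotNr quadP; congr (_ + _).
  by rewrite -!mulmxA dotMr sP quadM.
have le1 (N : 'M[R]_d) x : N^T = N -> N *m N = N -> dot (N *m x) (N *m x) <= dot x x.
  move=> sN NN; have := dot_ge0 (x - N *m x).
  have e : dot (N *m x) (N *m x) = dot (N *m x) x.
    by rewrite [LHS]dotMr sN mulmxA NN.
  by rewrite dotDr dotNr !dotDl !dotNl (dotC x (N *m x)) e; lra.
have [Q oQ [D GE]] := spectral sG.
have D01 i : 0 <= D 0 i <= 1.
  have : dot (col i Q) (col i Q) = 1.
    by have [QQ _] := orthogonalmxP oQ; rewrite dot_col QQ mxE eqxx.
  rewrite -(dot_spectral_col D i oQ) -GE quadG => cc; rewrite cc.
  have h1 := le1 P (col i Q) sP PP; rewrite cc in h1; have h2 := le1 M (P *m col i Q) sM MM.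
  have := dot_ge0 (M *m (P *m col i Q)); have := dot_ge0 (P *m col i Q).
  by move=> *; apply/andP; split; lra.
have detE : overlap M P = \prod_i D 0 i.
  rewrite /overlap -/G GE !det_mulmx det_diag mulrAC -det_mulmx.
  by have [_ ->] := orthogonalmxP oQ; rewrite det1 mul1r.
have det01 (S : pred 'I_d) : 0 <= \prod_(i | S i) D 0 i <= 1.
  rewrite prodr_ge0 ?prodr_ile1//=.
  by move=> i _; case/andP: (D01 i).
rewrite detE; split; try by case/andP: (det01 predT).
move=> Pv.
have -> : dot (M *m v) (M *m v) = dot v (G *m v).
  by rewrite quadG Pv subrr add0r.
rewrite GE dot_spectral (dot_coords v oQ) mulr_sumr; apply: ler_sum => i _.
rewrite ler_wpM2r ?sqr_ge0// (bigD1 i)//=.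
have /andP[D0 _] := D01 i; rewrite ler_piMr//.
by case/andP: (det01 (fun j => j != i)).
Qed.

Lemma transverse_overlap O m V : orthogonalmx O ->
  [/\ 0 <= overlap (cproj O m) (proj V), overlap (cproj O m) (proj V) <= 1 &
   transverse O m V (overlap (cproj O m) (proj V))].
Proof.
move=> oO.
have h v := overlap_bound v (proj_sym V) (proj_idem V) (cproj_sym O m) (cproj_idem m oO).
have [h1 h2 _] := h 0; split=> // v vV; have [_ _] := h v; apply.
exact: proj_id.
Qed.

End Overlap.

(** * Polynomials are small at few grid points *)

Section PolyFun.
Context {R : realType}.

(** Functions that agree with a polynomial of degree at most n. *)
Definition polyfun n (f : R -> R) :=
  exists2 q : {poly R}, (size q <= n.+1)%N & forall t, f t = q.[t].

Lemma polyfun_ext n f g : f =1 g -> polyfun n f -> polyfun n g.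
Proof. by move=> fg [q sq qE]; exists q => // t; rewrite -fg. Qed.

Lemma polyfun_cst n c : polyfun n (fun=> c).
Proof.
exists c%:P; first by rewrite (leq_trans (size_polyC_leq1 c)).
by move=> t; rewrite hornerC.
Qed.

Lemma polyfun_id n : (0 < n)%N -> polyfun n id.
Proof. by move=> n0; exists 'X => [|t]; rewrite ?size_polyX ?hornerX. Qed.

Lemma polyfunD n f g : polyfun n f -> polyfun n g -> polyfun n (fun t => f t + g t).
Proof.
move=> [p sp pE] [q sq qE]; exists (p + q); last by move=> t; rewrite hornerD pE qE.
by rewrite (leq_trans (size_polyD _ _))// geq_max sp.
Qed.

Lemma polyfunM m n f g : polyfun m f -> polyfun n g -> polyfun (m + n) (fun t => f t * g t).
Proof.
move=> [p sp pE] [q sq qE]; exists (p * q); last by move=> t; rewrite hornerM pE qE.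
by rewrite (leq_trans (size_polyMleq _ _))//; lia.
Qed.

Lemma polyfunZ n c f : polyfun n f -> polyfun n (fun t => c * f t).
Proof. exact: polyfunM (polyfun_cst 0 c). Qed.

Lemma polyfunN n f : polyfun n f -> polyfun n (fun t => - f t).
Proof. by move=> /(polyfunZ (-1)); apply: polyfun_ext => t; rewrite mulN1r. Qed.

Lemma polyfun_sum n I (r : seq I) (P : pred I) (F : I -> R -> R) :
  (forall i, polyfun n (F i)) -> polyfun n (fun t => \sum_(i <- r | P i) F i t).
Proof.
move=> h; elim: r => [|i r IH].
  by apply: polyfun_ext (polyfun_cst n 0) => t; rewrite big_nil.
have [Pi|Pi] := boolP (P i).
  by apply: polyfun_ext (polyfunD (h i) IH) => t; rewrite big_cons Pi.
by apply: polyfun_ext IH => t; rewrite big_cons (negbTE Pi).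
Qed.

Lemma polyfun_prod n I (r : seq I) (F : I -> R -> R) :
  (forall i, polyfun n (F i)) -> polyfun (size r * n) (fun t => \prod_(i <- r) F i t).
Proof.
move=> h; elim: r => [|i r IH].
  by apply: polyfun_ext (polyfun_cst _ 1) => t; rewrite big_nil.
by apply: polyfun_ext (polyfunM (h i) IH) => t; rewrite big_cons.
Qed.

Definition polymx n a b (A : R -> 'M[R]_(a, b)) := forall i j, polyfun n (fun t => A t i j).

Lemma polymx_cst n a b (A : 'M[R]_(a, b)) : polymx n (fun=> A).
Proof. by move=> i j; exact: polyfun_cst. Qed.

Lemma polymxM m n a b c (A : R -> 'M[R]_(a, b)) (B : R -> 'M[R]_(b, c)) :
  polymx m A -> polymx n B -> polymx (m + n) (fun t => A t *m B t).
Proof.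
move=> hA hB i j; have h k := polyfunM (hA i k) (hB k j).
by apply: polyfun_ext (polyfun_sum _ predT h) => t; rewrite mxE.
Qed.

Lemma polymx_tr n a b (A : R -> 'M[R]_(a, b)) : polymx n A -> polymx n (fun t => (A t)^T).
Proof. by move=> h i j; apply: polyfun_ext (h j i) => t; rewrite mxE. Qed.

Lemma polymxD n a b (A B : R -> 'M[R]_(a, b)) :
  polymx n A -> polymx n B -> polymx n (fun t => A t + B t).
Proof. by move=> hA hB i j; apply: polyfun_ext (polyfunD (hA i j) (hB i j)) => t; rewrite mxE. Qed.

Lemma polymxZ m n a b (f : R -> R) (A : R -> 'M[R]_(a, b)) :
  polyfun m f -> polymx n A -> polymx (m + n) (fun t => f t *: A t).
Proof. by move=> hf hA i j; apply: polyfun_ext (polyfunM hf (hA i j)) => t; rewrite mxE. Qed.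

Lemma polyfun_det n d (A : R -> 'M[R]_d) : polymx n A -> polyfun (d * n) (fun t => \det (A t)).
Proof.
move=> hA; apply: polyfun_sum => s; apply: polyfunZ.
have := polyfun_prod (enum 'I_d) (fun i => hA i (s i)); rewrite size_enum_ord.
by apply: polyfun_ext => t; rewrite big_enum.
Qed.

(** A quantitative form of the fact that a polynomial of degree n with n + 1 zeros
    vanishes.  In q - q(x) = (X - x) r the quotient r has degree n - 1 and is at
    most 2 e / h at the remaining points, so induction applies to r. *)
Lemma small_values n (e h t : R) (q : {poly R}) (s : seq R) : 0 < h <= 1 ->
  (size q <= n.+1)%N -> (n < size s)%N -> pairwise (fun x y => h <= `|x - y|) s ->
  {in s, forall x, `|q.[x]| <= e /\ `|t - x| <= 2} -> `|q.[t]| <= e * (5 / h) ^+ n.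
Proof.
move=> /andP[h0 h1]; elim: n e q s => [|n IH] e q [//|x s] sq ns.
  move=> _ /(_ x (mem_head _ _))[qx _].
  by move/size1_polyC: sq qx => ->; rewrite !hornerC expr0 mulr1.
move=> /= /andP[hx hs] qs.
have [qx tx] := qs x (mem_head _ _).
have e0 : 0 <= e by rewrite (le_trans _ qx).
have /factor_theorem[r qr] : root (q - q.[x]%:P) x.
  by rewrite rootE !hornerE subrr.
have qE y : q.[y] = q.[x] + r.[y] * (y - x).
  have := congr1 (fun p : {poly R} => p.[y]) qr.
  by rewrite !hornerE => <-; rewrite addrC subrK.
have sr : (size r <= n.+1)%N.
  have [->|r0] := eqVneq r 0; first by rewrite size_poly0.
  have : (size (q - q.[x]%:P)%R <= n.+2)%N.
    rewrite (leq_trans (size_polyD _ _))// geq_max sq size_polyN.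
    by rewrite (leq_trans (size_polyC_leq1 _)).
  by rewrite qr size_Mmonic ?monicXsubC// size_XsubC addn2.
have rt : `|r.[t]| <= (2 * e / h) * (5 / h) ^+ n.
  apply: (IH _ _ s) => // y ys.
  have [qy ty] := qs y (mem_behead (ys : y \in behead (x :: s))).
  split=> //; have /allP/(_ y ys) hxy := hx.
  rewrite ler_pdivlMr//.
  have : `|r.[y]| * `|y - x| <= 2 * e.
    rewrite -normrM; have -> : r.[y] * (y - x) = q.[y] - q.[x] by rewrite (qE y) addrAC subrr add0r.
    by rewrite (le_trans (ler_normB _ _))//; lra.
  by apply: le_trans; rewrite ler_wpM2l// distrC.
rewrite qE (le_trans (ler_normD _ _))// normrM.
(* The constant 5 satisfies e + 2 (2 e / h) (5 / h)^n <= e (5 / h)^(n + 1), since h <= 1. *)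
have f1 : 1 <= (5 / h) ^+ n by rewrite exprn_ege1// ler_pdivlMr//; lra.
set F := (5 / h) ^+ n in rt f1 *.
have rt' : `|r.[t]| * `|t - x| <= 2 * e / h * F * 2.
  by rewrite ler_pM.
have hi : 1 <= h^-1 by rewrite invf_ge1.
rewrite exprS -/F; set k := h^-1 in rt' hi *.
have : e <= e * (k * F).
  rewrite ler_peMr//; nra.
have -> : e * (5 * k * F) = e * (k * F) + 2 * e * k * F * 2 by ring.
lra.
Qed.

Definition grid_points N : seq R := [seq i%:R / N%:R | i <- iota 0 N].

Lemma grid_points_pairwise N : pairwise (fun x y => N%:R^-1 <= `|x - y|) (grid_points N).
Proof.
rewrite /grid_points pairwise_map.
have := iota_ltn_sorted 0 N; rewrite (sorted_pairwise ltn_trans).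
apply: sub_pairwise => i j /= ij.
have -> : i%:R / N%:R - j%:R / N%:R = - ((j - i)%:R / N%:R) :> R.
  by rewrite natrB 1?ltnW// mulrBl opprB.
rewrite normrN ger0_norm ?divr_ge0// ler_peMl ?invr_ge0// ler1n subn_gt0//.
Qed.

Lemma grid_points_range N x : x \in grid_points N -> 0 <= x <= 1.
Proof.
case/mapP => i; rewrite mem_iota add0n => /andP[_ iN] ->.
have N0 : 0 < N%:R :> R by rewrite ltr0n (leq_ltn_trans _ iN).
by rewrite divr_ge0//= ler_pdivrMr// mul1r ler_nat ltnW.
Qed.

(** A polynomial of degree n that is at least delta somewhere on [-1, 1] is at least
    delta times this number at all but n of the N grid points; 1 / N is their
    spacing, and the factor 2 turns a weak inequality into a strict one. *)
Definition shrinkage N n : R := (2 * (5 * N%:R) ^+ n)^-1.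

Lemma count_grid_points N n (q : {poly R}) (t delta : R) : (0 < N)%N -> (size q <= n.+1)%N ->
  `|t| <= 1 -> 0 < delta -> delta <= `|q.[t]| ->
  (count (fun x => (`|q.[x]| < delta * shrinkage N n)%R) (grid_points N) <= n)%N.
Proof.
move=> N0 sq t1 d0 dq; rewrite leqNgt; apply/negP; rewrite -size_filter => nf.
have NR : 0 < N%:R :> R by rewrite ltr0n.
have F0 : 0 < (5 * N%:R) ^+ n :> R by rewrite exprn_gt0// mulr_gt0.
suff : `|q.[t]| <= delta * shrinkage N n * (5 / N%:R^-1) ^+ n.
  move=> /(le_trans dq); rewrite invrK /shrinkage.
  by set F := (5 * _) ^+ n in F0 *; rewrite invfM mulrA mulfVK ?gt_eqF//; lra.
apply: small_values sq nf _ _.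
- by rewrite invr_gt0 NR invf_le1// ler1n.
- by apply: subseq_pairwise (grid_points_pairwise N); exact: filter_subseq.
move=> x; rewrite mem_filter => /andP[/ltW qx /grid_points_range/andP[x0 x1]].
by split=> //; move: t1; rewrite !ler_norml => /andP[? ?]; apply/andP; split; lra.
Qed.

Fixpoint grid N r : seq (seq R) :=
  if r is r'.+1 then flatten [seq [seq x :: s | s <- grid N r'] | x <- grid_points N]
  else [:: [::]].

Lemma size_grid N r : size (grid N r) = (N ^ r)%N.
Proof.
elim: r => //= r IH; rewrite size_flatten /shape -map_comp.
rewrite (eq_map (g := fun=> (N ^ r)%N)); last by move=> x /=; rewrite size_map.
rewrite expnS -[X in (X * _)%N](size_iota 0 N) -(size_map (fun i => i%:R / N%:R : R)).
by rewrite -/(grid_points N); elim: (grid_points N) => //= x l ->; rewrite mulSn.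
Qed.

Lemma grid_range N r s x : s \in grid N r -> x \in s -> 0 <= x <= 1.
Proof.
elim: r s => [|r IH] s /=; first by rewrite inE => /eqP ->.
case/flatten_mapP => y yp /mapP[s' s'g ->]; rewrite inE => /orP[/eqP ->|].
  exact: grid_points_range yp.
exact: IH.
Qed.

(** Polynomial of degree at most n in each of r variables separately. *)
Definition polyfuns n r (p : seq R -> R) := forall s1 s2 : seq R,
  (size s1 + size s2).+1 = r -> polyfun n (fun t => p (s1 ++ t :: s2)).

(** Move the good point x to the grid one coordinate at a time.  The first
    coordinate may be replaced by any of the N grid points but n, at the cost of
    one factor of shrinkage; induction handles the others.  The bad fraction is
    therefore at most r n / N. *)
Lemma count_grid N n r (p : seq R -> R) (x : seq R) (delta : R) : (0 < N)%N -> polyfuns n r p -> size x = r ->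
  {in x, forall t, `|t| <= 1} -> 0 < delta -> delta <= `|p x| ->
  (N * count (fun s => (`|p s| < delta * shrinkage N n ^+ r)%R) (grid N r) <= r * n * N ^ r)%N.
Proof.
move=> N0; have NR : 0 < N%:R :> R by rewrite ltr0n.
have sh0 : 0 < shrinkage N n by rewrite invr_gt0 mulr_gt0// exprn_gt0// mulr_gt0.
elim: r p x delta => [|r IH] p x delta hp.
  by move=> /size0nil -> _ d0 dp /=; rewrite expr0 mulr1 ltNge dp muln0.
case: x => // x0 x [sx] hx d0 dp.
have [q sq qE] := hp [::] x (congr1 S sx).
pose bad := fun t => `|q.[t]| < delta * shrinkage N n.
have cbad : (count bad (grid_points N) <= n)%N.
  apply: count_grid_points => //; first by apply: hx; exact: mem_head.
  by rewrite -qE.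
rewrite /= count_flatten -map_comp.
(* A bad first coordinate may spoil all N^r completions; a good one at most r n N^r / N of them. *)
have key t : t \in grid_points N ->
  (N * count (fun s => (`|p s| < delta * shrinkage N n ^+ r.+1)%R) [seq t :: s | s <- grid N r]
   <= r * n * N ^ r + bad t * N ^ r.+1)%N.
  move=> tp; rewrite count_map.
  have [bt|gt] := boolP (bad t).
    rewrite mul1n expnS (leq_trans _ (leq_addl _ _))// leq_mul2l -size_grid.
    by rewrite count_size orbT.
  rewrite mul0n addn0.
  rewrite (eq_count (a2 := fun s => `|p (t :: s)| < (delta * shrinkage N n) * shrinkage N n ^+ r)).
    apply: (IH (fun s => p (t :: s)) x) => //.
    - by move=> s1 s2 ss; apply: (hp (t :: s1) s2); rewrite /= -ss.
    - by move=> y yx; apply: hx; rewrite inE yx orbT.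
    - by rewrite mulr_gt0.
    by move: gt; rewrite /bad -leNgt -qE.
  by move=> s /=; rewrite exprS mulrA.
have : (N * sumn [seq (count (fun s => (`|p s| < delta * shrinkage N n ^+ r.+1)%R) \o
        (fun x1 : R => [seq x1 :: s | s <- grid N r])) i | i <- grid_points N] <=
   size (grid_points N) * (r * n * N ^ r) + count bad (grid_points N) * N ^ r.+1)%N.
  elim: (grid_points N) key => [|t l IHl] key /=; first by rewrite muln0.
  have := key t (mem_head _ _); have := IHl (fun y yl => key y (mem_behead (yl : y \in behead (t :: l)))).
  rewrite mulnDr !mulnDl /=; lia.
move/leq_trans; apply; rewrite size_map size_iota.
have := leq_mul cbad (leqnn (N ^ r.+1)); rewrite !expnS; nia.
Qed.

End PolyFun.

(** * Products of reflections *)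

Section Reflections.
Context {R : realType} {d : nat}.
Implicit Types (l : seq 'cV[R]_d) (M P : 'M[R]_d) (u v : 'cV[R]_d).

Definition reflections l : 'M[R]_d := foldr (fun u Q => reflection u *m Q) 1%:M l.

Lemma orthogonalmx_reflections l : orthogonalmx (reflections l).
Proof. by elim: l => [|u l IH] /=; [exact: orthogonalmx1|apply: orthogonalmxM; rewrite ?orthogonalmx_reflection]. Qed.

Lemma reflection_normalize u : reflection ((Num.sqrt (dot u u))^-1 *: u) = reflection u.
Proof.
have [->|u0] := eqVneq u 0; first by rewrite scaler0.
have up : 0 < dot u u by rewrite dot_gt0.
set c := Num.sqrt _; have c0 : c != 0 by rewrite sqrtr_eq0 -ltNge.
have cc : c ^+ 2 = dot u u by rewrite sqr_sqrtr// ltW.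
rewrite /reflection; congr (_ - _); rewrite dotZl dotZr linearZ /= -scalemxAl -scalemxAr !scalerA.
by congr (_ *: _); rewrite -cc; field.
Qed.

Lemma dot_normalize u : u != 0 ->
  dot ((Num.sqrt (dot u u))^-1 *: u) ((Num.sqrt (dot u u))^-1 *: u) = 1.
Proof.
move=> u0; have up : 0 < dot u u by rewrite dot_gt0.
set c := Num.sqrt _; have c0 : c != 0 by rewrite sqrtr_eq0 -ltNge.
have cc : c ^+ 2 = dot u u by rewrite sqr_sqrtr// ltW.
by rewrite dotZl dotZr -cc; field.
Qed.

(** Triangularization by reflections: the next reflection carries the image of
    the k-th column to the k-th basis vector up to sign.  Since the image of X
    stays orthogonal, the reflection fixes the basis vectors already reached. *)
Lemma householder_partial (X : 'M[R]_d) k : orthogonalmx X -> (k <= d)%N ->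
  exists2 l, size l = k /\ {in l, forall u, dot u u = 1} &
  forall i : 'I_d, (i < k)%N -> exists2 e, e ^+ 2 = 1 &
    reflections l *m col i X = e *: delta_mx i 0.
Proof.
move=> oX; elim: k => [|k IH] kd; first by exists [::].
have [l [sl l1] lX] := IH (ltnW kd).
pose ik := Ordinal kd; pose Y := reflections l *m X.
have oY : orthogonalmx Y by apply: orthogonalmxM => //; exact: orthogonalmx_reflections.
have [YY _] := orthogonalmxP oY.
have colY i : reflections l *m col i X = col i Y by rewrite /Y !colE mulmxA.
have Y1 : dot (col ik Y) (col ik Y) = 1 by rewrite dot_col YY mxE eqxx.
have d1 : dot (delta_mx ik 0) (delta_mx ik 0) = 1 :> R by rewrite dot_delta mxE !eqxx.
have Y0 : col ik Y != 0 by rewrite -dot_eq0 Y1 oner_neq0.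
have [u u0 [[e e1 ue] uz]] := reflection_exists Y0 (etrans Y1 (esym d1)).
exists ((Num.sqrt (dot u u))^-1 *: u :: l).
  split=> [/=|v]; first by rewrite sl.
  by rewrite inE => /orP[/eqP ->|/l1//]; exact: dot_normalize.
move=> i; rewrite ltnS leq_eqVlt /= reflection_normalize -mulmxA => /orP[/eqP ik'|ik'].
  have -> : i = ik by apply: val_inj.
  by exists e => //; rewrite colY.
have [f f1 lf] := lX i ik'; exists f => //.
rewrite lf -scalemxAr reflection_orth//; apply: uz.
  have f0 : f != 0 by rewrite -sqrf_eq0 f1 oner_neq0.
  apply: (mulfI f0); rewrite -dotZr -lf colY dot_col YY mxE mulr0.
  by rewrite -val_eqE /= gtn_eqF.
by rewrite dot_delta mxE -val_eqE /= gtn_eqF.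
Qed.

Lemma householder (X : 'M[R]_d) : orthogonalmx X ->
  exists2 l, size l = d /\ {in l, forall u, dot u u = 1} &
  exists2 D : 'rV[R]_d, (forall i, D 0 i ^+ 2 = 1) & reflections l *m X = diag_mx D.
Proof.
move=> oX; have [l lP lX] := householder_partial oX (leqnn d).
exists l => //.
have h i : exists e, e ^+ 2 = 1 /\ reflections l *m col i X = e *: delta_mx i 0.
  by have [e ? ?] := lX i (ltn_ord i); exists e.
have [f fP] := choice h.
exists (\row_i f i) => [i|]; first by rewrite mxE (fP i).1.
apply/matrixP => i j.
have := congr1 (fun v : 'cV[R]_d => v i 0) (fP j).2.
have -> : reflections l *m col j X = col j (reflections l *m X) by rewrite !colE mulmxA.
by rewrite mxE => ->; rewrite !mxE andbT eq_sym mulr_natr; case: eqP => // ->.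
Qed.

(** The reflection multiplied by |u|^2, which clears its denominator. *)
Definition scaled_reflection u : 'M[R]_d := dot u u *: 1%:M - 2 *: (u *m u^T).
Definition scaled_reflections l : 'M[R]_d := foldr (fun u Q => scaled_reflection u *m Q) 1%:M l.
Definition norm_product l : R := \prod_(u <- l) dot u u.

Lemma scaled_reflectionE u : scaled_reflection u = dot u u *: reflection u.
Proof.
have [->|u0] := eqVneq u 0; first by rewrite /scaled_reflection dot0l !scale0r mul0mx scaler0 subr0.
by rewrite /reflection scalerBr scalerA mulrCA divff ?mulr1// dot_eq0.
Qed.

Lemma scaled_reflectionsE l : scaled_reflections l = norm_product l *: reflections l.
Proof.
rewrite /norm_product; elim: l => [|u l IH] /=; first by rewrite big_nil scale1r.
by rewrite big_cons scaled_reflectionE IH -scalemxAl -scalemxAr scalerA.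
Qed.

(** Reads a list of d * d numbers as d column vectors. *)
Definition columns_of_seq (s : seq R) := [seq \col_(j < d) s`_(i * d + j) | i <- iota 0 d].

(** The determinant that defines the overlap after the subspace is moved by the
    reflections, with all denominators cleared; hence a polynomial in the entries
    of s. *)
Definition overlap_poly M P (s : seq R) : R :=
  \det (norm_product (columns_of_seq s) ^+ 2 *: (1%:M - P) +
        P *m ((scaled_reflections (columns_of_seq s))^T *m M *m scaled_reflections (columns_of_seq s)) *m P).

Lemma overlap_polyE M P s : overlap_poly M P s = (norm_product (columns_of_seq s) ^+ 2) ^+ d *
  overlap ((reflections (columns_of_seq s))^T *m M *m reflections (columns_of_seq s)) P.
Proof.
rewrite /overlap_poly /overlap -detZ; congr (\det _); rewrite [RHS]scalerDr; congr (_ + _).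
rewrite scaled_reflectionsE; set c := norm_product _; set H := reflections _.
have -> : (c *: H)^T = c *: H^T by rewrite linearZ.
rewrite -!scalemxAl -!scalemxAr -!scalemxAl scalerA -expr2.
by rewrite !mulmxA.
Qed.

Lemma polymx_scaled_reflections I (r : seq I) (f : I -> R -> 'cV[R]_d) :
  (forall i, polymx 1 (f i)) -> polymx (size r * 2) (fun t => scaled_reflections [seq f i t | i <- r]).
Proof.
move=> hf; elim: r => [|i r IH]; first exact: polymx_cst.
have ii : polymx 2 (fun t => f i t *m (f i t)^T).
  by apply: (polymxM (m := 1) (n := 1)) => //; exact: polymx_tr.
have dd : polyfun 2 (fun t => dot (f i t) (f i t)).
  have := polymxM (polymx_tr (hf i)) (hf i) => /(_ 0 0); exact.
change (polymx (2 + size r * 2) (fun t => scaled_reflection (f i t) *m scaled_reflections [seq f j t | j <- r])).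
apply: (polymxM (A := fun t => scaled_reflection (f i t)) _ IH) => a b.
apply: (polymxD _ _ a b).
  exact: (polymxZ dd (polymx_cst 0 _)).
move=> a' b'; apply: polyfun_ext (polyfunN (polyfunZ 2 (ii a' b'))) => t.
by rewrite [RHS]mxE [X in _ = - X]mxE.
Qed.

Lemma polyfun_norm_product I (r : seq I) (f : I -> R -> 'cV[R]_d) :
  (forall i, polymx 1 (f i)) -> polyfun (size r * 2) (fun t => norm_product [seq f i t | i <- r]).
Proof.
move=> hf; have h i : polyfun 2 (fun t => dot (f i t) (f i t)).
  have := polymxM (polymx_tr (hf i)) (hf i) => /(_ 0 0); exact.
by apply: polyfun_ext (polyfun_prod r h) => t; rewrite /norm_product big_map.
Qed.

(** The d scaled reflections are quadratic, and each of them occurs twice in every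
    matrix entry; the determinant multiplies the degree by d. *)
Definition overlap_degree := (d * (d * 2 + d * 2))%N.

Lemma overlap_poly_polyfuns M P : polyfuns overlap_degree (d * d) (overlap_poly M P).
Proof.
move=> s1 s2 _; apply: polyfun_det.
pose f (i : nat) (t : R) : 'cV[R]_d := \col_(j < d) (s1 ++ t :: s2)`_(i * d + j).
have hf i : polymx 1 (f i).
  move=> a b; set k := (i * d + a)%N.
  have [ks|sk] := ltnP k (size s1).
    apply: polyfun_ext (polyfun_cst 1 s1`_k) => t.
    by rewrite mxE nth_cat ks.
  have [ks|ks] := eqVneq k (size s1).
    apply: polyfun_ext (polyfun_id (isT : (0 < 1)%N)) => t.
    by rewrite mxE nth_cat -/k ks ltnn subnn.
  apply: polyfun_ext (polyfun_cst 1 s2`_(k - size s1).-1) => t.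
  rewrite mxE nth_cat -/k ltnNge sk /=.
  have : (0 < k - size s1)%N by rewrite subn_gt0 ltn_neqAle eq_sym ks.
  by case: (k - size s1)%N.
have hk := polymx_scaled_reflections (iota 0 d) hf.
have hn := polyfun_norm_product (iota 0 d) hf.
rewrite size_iota in hk hn.
apply: polymxD.
  rewrite -[X in polymx X]addn0; apply: polymxZ; last exact: polymx_cst.
  by apply: polyfun_ext (polyfunM hn hn) => t; rewrite expr2.
have h1 := polymxM (polymxM (polymx_tr hk) (polymx_cst 0 M)) hk.
have := polymxM (polymxM (polymx_cst 0 P) h1) (polymx_cst 0 P).
by rewrite add0n !addn0.
Qed.

Lemma norm_product_ge0 l : 0 <= norm_product l.
Proof. by apply: prodr_ge0 => u _; exact: dot_ge0. Qed.

Lemma norm_product_le s : {in s, forall x, 0 <= x <= 1} -> norm_product (columns_of_seq s) <= d%:R ^+ d.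
Proof.
move=> hs; rewrite /norm_product /columns_of_seq big_map -[X in _ ^+ X](size_iota 0 d).
elim: (iota 0 d) => [|i r IH] /=; first by rewrite big_nil.
rewrite big_cons exprS ler_pM ?dot_ge0//.
  by apply: prodr_ge0 => k _; exact: dot_ge0.
rewrite dotE -[leRHS](_ : \sum_(j < d) 1 = _); last by rewrite sumr_const card_ord.
apply: ler_sum => j _; rewrite mxE.
have /andP[x0 x1] : 0 <= s`_(i * d + j) <= 1.
  have [ks|sk] := ltnP (i * d + j) (size s); first by apply: hs; exact: mem_nth.
  by rewrite nth_default// lexx ler01.
by rewrite -[leRHS]mulr1 ler_pM.
Qed.

(** Bounds the factor by which clearing denominators multiplies the overlap when
    the normal vectors have entries in [0, 1]. *)
Definition norm_bound : R := (d%:R ^+ d) ^+ 2 ^+ d.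

Lemma overlap_poly_le M P s : {in s, forall x, 0 <= x <= 1} ->
  0 <= overlap ((reflections (columns_of_seq s))^T *m M *m reflections (columns_of_seq s)) P ->
  `| overlap_poly M P s | <= norm_bound * overlap ((reflections (columns_of_seq s))^T *m M *m reflections (columns_of_seq s)) P.
Proof.
move=> hs o0; rewrite overlap_polyE ger0_norm; last by rewrite mulr_ge0 ?exprn_ge0 ?norm_product_ge0.
rewrite ler_wpM2r// lerXn2r ?nnegrE ?exprn_ge0 ?norm_product_ge0//.
by rewrite lerXn2r ?nnegrE ?exprn_ge0 ?norm_product_ge0// norm_product_le.
Qed.

(** The eigenvalues of a projection are 0 and 1 and are sorted, so it is
    diagonalized to a partial identity; the number of ones is the dimension of
    V, since otherwise kernel_coords produces a nonzero vector of V killed by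
    the projection or a nonzero vector of the complement fixed by it. *)
Lemma proj_pid (V : {vspace 'cV[R]_d}) : exists2 X, orthogonalmx X & proj V = cproj X (\dim V).
Proof.
have [X oX [D PE Dle]] := spectral_sorted (proj_sym V).
have [XX _] := orthogonalmxP oX.
exists X => //; rewrite PE /cproj; congr (_ *m _ *m _).
have Pcoord v i : (X^T *m (proj V *m v)) i 0 = D 0 i * (X^T *m v) i 0.
  by rewrite PE !mulmxA XX mul1mx -mulmxA mul_diag_mx mxE.
have DD i : D 0 i = 0 \/ D 0 i = 1.
  have := Pcoord (proj V *m col i X) i; rewrite (mulmxA (proj V)) proj_idem !Pcoord.
  have -> : (X^T *m col i X) i 0 = 1 by rewrite colE mulmxA XX mul1mx mxE !eqxx.
  rewrite !mulr1 => e; have /eqP : D 0 i * (D 0 i - 1) = 0 by rewrite mulrBr mulr1 -e subrr.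
  by rewrite mulf_eq0 subr_eq0 => /orP[] /eqP; [left|right].
have inj v : (forall i, (X^T *m v) i 0 = 0) -> v = 0.
  move=> v0; apply/eqP; rewrite -dot_eq0 (dot_coords v oX) big1// => i _.
  by rewrite v0 expr0n.
apply/matrixP => i j; rewrite [RHS]mxE [LHS]mxE (_ : (i == j :> nat) = (i == j))//.
have [_|//] := eqVneq i j; rewrite mulr1n /=.
have [im|mi] /= := ltnP i (\dim V).
  case: (DD i) => // Di0.
  have [|v vV [v0 Xv]] := @kernel_coords _ _ V X^T [pred j : 'I_d | (j < i)%N].
    by rewrite card_ord_ltn// ltnW.
  suff v00 : v = 0 by rewrite v00 eqxx in v0.
  apply: inj => k; rewrite -(proj_id vV) Pcoord.
  have [ki|ik] := ltnP k i; first by rewrite Xv// mulr0.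
  have := Dle _ _ ik; rewrite Di0; case: (DD k) => ->; rewrite ?mul0r// ler10.
  by [].
case: (DD i) => // Di1.
have [|v vV [v0 Xv]] := @kernel_coords _ _ (orthocomp V) X^T [pred j : 'I_d | (i.+1 <= j)%N].
  by rewrite card_ord_geq// dim_orthocomp; have := ltn_ord i; lia.
suff v00 : v = 0 by rewrite v00 eqxx in v0.
apply: inj => k; have := Pcoord v k; rewrite proj_orth0// mulmx0 mxE.
have [ki|ik] := leqP k i; last by rewrite Xv.
have := Dle _ _ ki; rewrite Di1; case: (DD k) => ->; rewrite ?ler10//.
by rewrite mul1r.
Qed.

(** Reflections with unit normals carry an orthonormal basis adapted to V to the
    standard basis up to signs.  They move V to the span of the first basis
    vectors, where the overlap is 1, and unit normals have entries in [-1, 1]. *)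
Lemma overlap_poly_attains (V : {vspace 'cV[R]_d}) : exists x : seq R,
  [/\ size x = (d * d)%N, {in x, forall t, `|t| <= 1} &
      overlap_poly (pid_mx (\dim V)) (proj V) x = 1].
Proof.
have [X oX PE] := proj_pid V; set m := \dim V in PE *.
have [l [sl l1] [D D1 lX]] := householder oX.
pose g k : R := oapp (fun j : 'I_d => (nth 0 l (k %/ d)%N) j 0) 0 (insub (k %% d)%N).
pose x := mkseq g (d * d).
have vx : columns_of_seq x = l.
  apply: (eq_from_nth (x0 := 0)); rewrite /columns_of_seq size_map size_iota ?sl// => i id.
  rewrite (nth_map 0) ?size_iota// nth_iota// add0n; apply/colP => j.
  have jd := ltn_ord j; have d0 : (0 < d)%N by exact: leq_ltn_trans jd.
  rewrite mxE nth_mkseq; last first.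
    by rewrite (leq_trans (n := (i.+1 * d)%N))// ?leq_mul2r ?id ?orbT// mulSn addnC ltn_add2r.
  by rewrite /g divnMDl// divn_small// addn0 modnMDl modn_small// (valK j : insub (j : nat) = Some j).
exists x; split; first by rewrite size_mkseq.
  move=> t /mapP[k _ ->]; rewrite /g; case: insubP => [j _ _|_] /=; last by rewrite normr0.
  have [kl|lk] := ltnP (k %/ d) (size l); last by rewrite nth_default// mxE normr0.
  have := l1 _ (mem_nth 0 kl); set u := nth _ _ _; rewrite dotE (bigD1 j)//= => e.
  rewrite -[_ <= 1](@ler_pXn2r _ 2)// ?nnegrE// expr1n real_normK ?num_real//.
  by rewrite -e expr2 lerDl sumr_ge0// => i _; rewrite -expr2 sqr_ge0.
rewrite overlap_polyE vx; set H := reflections l.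
have -> : norm_product l = 1 by rewrite /norm_product big1_seq// => u /andP[_ /l1].
rewrite !expr1n mul1r /overlap.
suff -> : proj V *m (H^T *m pid_mx m *m H) *m proj V = proj V by rewrite subrK det1.
have JS : pid_mx m *m diag_mx D = diag_mx D *m pid_mx m.
  rewrite mul_mx_diag mul_diag_mx; apply/matrixP => i j; rewrite !mxE mulrC.
  by case: eqP => [/val_inj ->|_] //=; rewrite !mulr0.
have SS : diag_mx D *m diag_mx D = 1%:M.
  by rewrite mul_diag_mx; apply/matrixP => i j; rewrite !mxE mulrnAr -expr2 D1.
have JJ : (pid_mx m : 'M[R]_d) *m (pid_mx m : 'M[R]_d) = pid_mx m by rewrite mul_pid_mx minnn pid_mx_minv.
have -> : proj V *m (H^T *m pid_mx m *m H) *m proj V =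
   X *m (pid_mx m *m (H *m X)^T *m pid_mx m *m (H *m X) *m pid_mx m) *m X^T.
  by rewrite PE /cproj trmx_mul !mulmxA.
rewrite lX tr_diag_mx PE /cproj; congr (_ *m _ *m _).
rewrite JS -(mulmxA _ (pid_mx m) (pid_mx m)) JJ -(mulmxA _ (pid_mx m) (diag_mx D)).
by rewrite JS (mulmxA _ _ (pid_mx m)) SS mul1mx.
Qed.

End Reflections.

(** * Integrals on a probability space *)

Section Measure.
Context (dd : measure_display) (T : measurableType dd) (R : realType).
Local Open Scope ereal_scope.

(** The integral of a nonnegative function, measurable or not, is a supremum over
    the simple functions below it. *)
Lemma ge0_integral_le (mu : measure T R) (f g : T -> \bar R) :
  (forall x, 0 <= f x) -> (forall x, f x <= g x) ->
  \int[mu]_x f x <= \int[mu]_x g x.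
Proof.
move=> f0 fg; have g0 x : 0 <= g x by exact: le_trans (f0 x) (fg x).
rewrite !ge0_integralTE//; apply: ereal_sup_le => _ [h hf <-].
by exists h => // x; exact: le_trans (hf x) (fg x).
Qed.

(** Sets that cover no point with total multiplicity above c have total
    probability at most c: integrate the sum of their indicators. *)
Lemma sum_measure_le (P : probability T R) (I : Type) (s : seq I) (S : I -> set T) (c : R) :
  (forall i, measurable (S i)) ->
  (forall x, \sum_(i <- s) (\1_(S i) x)%:E <= c%:E) ->
  \sum_(i <- s) P (S i) <= c%:E.
Proof.
move=> mS Sc.
have -> : \sum_(i <- s) P (S i) = \int[P]_x \sum_(i <- s) (\1_(S i) x)%:E.
  rewrite ge0_integral_sum//.
  - by apply: eq_bigr => i _; rewrite integral_indic// setIT.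
  - by move=> i; apply/measurable_EFinP; exact: measurable_indic.
apply: (@le_trans _ _ (\int[P]_x cst c%:E x)); last first.
  by rewrite integral_cst// [X in _ * X]probability_setT mule1.
by apply: ge0_integral_le => // x; apply: sume_ge0.
Qed.

(** For the lower bound, the measurable function max (L - H, 0) lies below f. *)
Lemma integral_close (P : probability T R) (f : T -> R) (L C : R) (H : T -> \bar R) :
  (forall x, (0 <= f x)%R) -> (0 <= L)%R -> (forall x, 0 <= H x) -> measurable_fun setT H ->
  \int[P]_x H x <= C%:E ->
  (forall x, (f x)%:E <= L%:E + H x) -> (forall x, L%:E <= (f x)%:E + H x) ->
  `| \int[P]_x (f x)%:E - L%:E | <= C%:E.
Proof.
move=> f0 L0 H0 mH HC up lo.
have LE : \int[P]_x L%:E = L%:E by rewrite integral_cst// [X in _ * X]probability_setT mule1.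
have upper : \int[P]_x (f x)%:E <= L%:E + C%:E.
  apply: (@le_trans _ _ (\int[P]_x (L%:E + H x))); first exact: ge0_integral_le.
  by rewrite ge0_integralD// LE leeD2l.
have F0 : 0 <= \int[P]_x (f x)%:E by apply: integral_ge0 => x _; rewrite lee_fin.
have lower : L%:E <= \int[P]_x (f x)%:E + C%:E.
  pose g x := maxe (L%:E - H x) 0.
  have mg : measurable_fun setT g.
    by apply: measurable_maxe => //; exact: emeasurable_funB.
  have g0 x : 0 <= g x by rewrite le_max lexx orbT.
  rewrite -LE; apply: (@le_trans _ _ (\int[P]_x (g x + H x))).
    apply: ge0_integral_le => // x; rewrite /g.
    have := H0 x; case: (H x) => [h| |]//=; last first.
      by rewrite addey ?leey// -ltNye (lt_le_trans (ltNyr 0))// le_max lexx orbT.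
    by rewrite -leeBlDr// le_max lexx.
  rewrite ge0_integralD// leeD//; apply: ge0_integral_le => // x.
  rewrite /g ge_max lee_fin f0 andbT.
  have := lo x; have := H0 x; case: (H x) => [h _ Lh|_ _|//]; first by rewrite leeBlDr.
  by rewrite leNye.
move: F0 upper lower; case: (\int[P]_x (f x)%:E) => [r| |]//=; rewrite ?lee_fin.
by move=> _ h1 h2; rewrite ler_norml; apply/andP; split; lra.
Qed.

End Measure.

(** * Logarithmic integrability of the overlap *)

Section Orthogonal.
Context {R : realType} {d : nat}.
Implicit Types (V : {vspace 'cV[R]_d}) (M P Q : 'M[R]_d).

Lemma proj_mximg Q V : orthogonalmx Q -> proj (mximg Q V) = Q *m proj V *m Q^T.
Proof.
move=> oQ; have [QQ QQ'] := orthogonalmxP oQ.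
have e (A : 'M[R]_d) k l : A k l = (A *m delta_mx l (0 : 'I_1)) k 0.
  by rewrite -colE [RHS]mxE.
apply/matrixP => i j; rewrite e [RHS]e; congr (fun_of_matrix _ _ _).
apply: proj_eq; rewrite -!mulmxA; first exact/mem_mximg/proj_mem.
set v := delta_mx _ _; apply/dot_orthocompP => _ /mximgP[u uV ->].
rewrite dotDr dotNr dot_orthogonalmx// dot_proj// dotMl subrr //.
Qed.

(** Moving the subspace by Q amounts to moving the reference matrix by the inverse
    of Q. *)
Lemma overlap_conj M P Q : orthogonalmx Q -> overlap M (Q *m P *m Q^T) = overlap (Q^T *m M *m Q) P.
Proof.
move=> /orthogonalmxP[QQ QQ']; rewrite /overlap.
have -> : 1%:M - Q *m P *m Q^T + Q *m P *m Q^T *m M *m (Q *m P *m Q^T) =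
  Q *m (1%:M - P + P *m (Q^T *m M *m Q) *m P) *m Q^T.
  by rewrite mulmxDr mulmxDl mulmxBr mulmxBl mulmx1 QQ' !mulmxA.
by rewrite !det_mulmx mulrAC -det_mulmx QQ' det1 mul1r.
Qed.

Lemma continuous_mul (T : topologicalType) (f g : T -> R) :
  continuous f -> continuous g -> continuous (fun x => f x * g x).
Proof. by move=> cf cg x; apply: cvgM; [exact: cf|exact: cg]. Qed.

Lemma continuous_overlap M (T : topologicalType) (f : T -> 'M[R]_d) :
  (forall i j, continuous (fun x => f x i j)) ->
  continuous (fun x => overlap M (f x)).
Proof.
move=> cf.
have csum (I : finType) (F : I -> T -> R) : (forall i, continuous (F i)) ->
    continuous (fun x => \sum_i F i x).
  move=> cF x; apply: cvg_big; first by move=> z; apply: cvgD; [exact: cvg_fst|exact: cvg_snd].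
  by move=> i _; exact: cF.
have cmul a b c (A : T -> 'M[R]_(a, b)) (B : T -> 'M[R]_(b, c)) :
    (forall i j, continuous (fun x => A x i j)) -> (forall i j, continuous (fun x => B x i j)) ->
    forall i j, continuous (fun x => (A x *m B x) i j).
  move=> cA cB i j; rewrite (_ : (fun x => _) = (fun x => \sum_k A x i k * B x k j)).
    by apply: csum => k; exact: continuous_mul.
  by apply/funext => x; rewrite mxE.
have cG i j : continuous (fun x => (1%:M - f x + f x *m M *m f x) i j).
  rewrite (_ : (fun x => _) = (fun x => ((1%:M : 'M[R]_d) i j - f x i j) + (f x *m M *m f x) i j)).
    move=> x; apply: cvgD; first by apply: cvgB; [exact: cvg_cst|exact: cf].
    apply: (cmul _ _ _ (fun x => f x *m M) f _ cf).
    by apply: cmul => // k l; exact: cst_continuous.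
  apply/funext => x; rewrite [LHS]mxE; congr (_ + _).
  by rewrite [LHS]mxE; congr (_ + _); rewrite [LHS]mxE.
apply: csum => s; apply: continuous_mul; first exact: cst_continuous.
move=> x; apply: cvg_big; first by move=> z; apply: cvgM; [exact: cvg_fst|exact: cvg_snd].
by move=> i _; exact: cG.
Qed.

End Orthogonal.

Section Tail.
Context {R : realType} {d k : nat} (hk : (1 <= k < d)%N) (m : nat).
Variables (sel : PF R hk -> {vspace 'cV[R]_d}) (lambda : probability (borelPF R hk) R).
Hypotheses (haar : is_haar lambda).
Hypothesis (selc : forall i j, continuous (fun V : PF R hk => proj (sel V) i j)).
Hypothesis (sela : forall (Q : @orthogonal_group R d) V, sel (flag_act Q V) = mximg (val Q) (sel V)).
Hypothesis (seld : forall V, \dim (sel V) = m).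

Definition low_overlap M e : set (borelPF R hk) := [set V | overlap M (proj (sel V)) < e].

Lemma low_overlap_measurable M e : measurable (low_overlap M e).
Proof.
apply: sub_sigma_algebra.
have /continuousP := @continuous_overlap _ _ M _ _ selc.
by move=> /(_ [set x | x < e]); apply; exact: open_lt.
Qed.

(** The invariance of the measure in the form used for averaging over Q. *)
Lemma low_overlap_invariant M e (Q : 'M[R]_d) : orthogonalmx Q ->
  lambda (low_overlap (Q^T *m M *m Q) e) = lambda (low_overlap M e).
Proof.
move=> oQ; pose q : @orthogonal_group R d := exist _ Q oQ.
rewrite -(haar q (low_overlap_measurable M e)); congr (lambda _).
by apply/seteqP; split=> V; rewrite /low_overlap /= sela/= proj_mximg// overlap_conj.
Qed.

Let r := (d * d)%N.
Let n := @overlap_degree d.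
(** The value below which the overlap falls on at most a fraction O(1 / N) of the
    grid. *)
Definition level N : R := shrinkage N n ^+ r / @norm_bound R d.

(** Average over the grid of products of reflections: each of these products gives
    a set of the same measure, while count_grid limits how many of these sets
    contain a given flag. *)
Lemma low_overlap_tail O N : orthogonalmx O -> (0 < N)%N ->
  (lambda (low_overlap (cproj O m) (level N)) <= ((r * n)%:R / N%:R)%:E)%E.
Proof.
move=> oO N0; set e := level N.
pose Ms s := (reflections (columns_of_seq s))^T *m pid_mx m *m reflections (columns_of_seq s) : 'M[R]_d.
have d0 : (0 < d)%N by case/andP: hk => _; exact: leq_ltn_trans.
have tb0 : 0 < @norm_bound R d by rewrite !exprn_gt0// ltr0n.
have MsE s : Ms s = (O *m reflections (columns_of_seq s))^T *m cproj O m *m (O *m reflections (columns_of_seq s)).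
  rewrite /Ms /cproj trmx_mul !mulmxA; have [OO _] := orthogonalmxP oO.
  by rewrite -(mulmxA _ O^T O) OO mulmx1 -(mulmxA _ O^T O) OO mulmx1.
have Msb s : lambda (low_overlap (Ms s) e) = lambda (low_overlap (cproj O m) e).
  by rewrite MsE low_overlap_invariant// orthogonalmxM// orthogonalmx_reflections.
have Ms0 s V : 0 <= overlap (Ms s) (proj (sel V)).
  have -> : Ms s = cproj (reflections (columns_of_seq s))^T m by rewrite /cproj trmxK.
  by have [] := transverse_overlap m (sel V) (orthogonalmx_tr (orthogonalmx_reflections (columns_of_seq s))).
pose c := (r * n * N ^ r)%N.
have cnt V : (N * count (fun s => (overlap (Ms s) (proj (sel V)) < e)%R) (grid N r) <= c)%N.
  have [x [sx x1 tx]] := overlap_poly_attains (sel V).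
  have := count_grid N0 (overlap_poly_polyfuns (pid_mx m) (proj (sel V))) sx x1 ltr01.
  rewrite -(seld V) tx normr1 => /(_ (lexx _)); apply: leq_trans.
  rewrite leq_mul2l; apply/orP; right.
  have sub s : s \in grid N r -> overlap (Ms s) (proj (sel V)) < e ->
      `|overlap_poly (pid_mx m) (proj (sel V)) s| < 1 * shrinkage N n ^+ r.
    move=> sg lte; rewrite mul1r (le_lt_trans (overlap_poly_le (fun x xs => grid_range sg xs) (Ms0 s V)))//.
    by rewrite mulrC -ltr_pdivlMr.
  rewrite (seld V); elim: (grid N r) sub => //= s l IHl sub.
  rewrite leq_add ?IHl//; last by move=> t tl; apply: sub; rewrite inE tl orbT.
  by have := sub s (mem_head _ _); case: (overlap _ _ < e) => // ->.
have := @sum_measure_le _ _ _ lambda _ (grid N r) (fun s => low_overlap (Ms s) e) (c%:R / N%:R).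
move=> /(_ (fun s => low_overlap_measurable _ _)).
have NR : 0 < N%:R :> R by rewrite ltr0n.
have fl : lambda (low_overlap (cproj O m) e) \is a fin_num by exact: fin_num_measure (low_overlap_measurable _ _).
rewrite (eq_bigr (fun=> (fine (lambda (low_overlap (cproj O m) e)))%:E)); last first.
  by move=> s _; rewrite Msb fineK.
rewrite sumEFin big_const_seq count_predT size_grid iter_addr_0.
rewrite -[X in _ -> (X <= _)%E](fineK fl) !lee_fin.
set x := fine _; have NrR : 0 < (N ^ r)%:R :> R by rewrite ltr0n expn_gt0 N0.
move=> h; suff : x *+ (N ^ r) <= c%:R / N%:R.
  have -> : c%:R = (r * n)%:R * (N ^ r)%:R :> R by rewrite -natrM.
  by rewrite -[x *+ _]mulr_natr mulrAC ler_pM2r.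
apply: h => V; rewrite sumEFin lee_fin ler_pdivlMr//.
have -> : \sum_(s <- grid N r) \1_(low_overlap (Ms s) e) V =
   (count (fun s => overlap (Ms s) (proj (sel V)) < e) (grid N r))%:R :> R.
  elim: (grid N r) => [|s l IHl] /=; first by rewrite big_nil.
  rewrite big_cons IHl natrD indicE; congr (_%:R + _).
  by congr nat_of_bool; apply/idP/idP; rewrite inE.
by rewrite -natrM ler_nat mulnC.
Qed.

(** The number of dyadic levels that the overlap falls below. *)
Definition low_overlap_count O (V : borelPF R hk) : \bar R :=
  \big[+%E/0%E]_(0 <= j <oo) (\1_(low_overlap (cproj O m) (level (2 ^ j)%N)) V)%:E.

Lemma low_overlap_count_ge0 O V : (0 <= low_overlap_count O V)%E.
Proof. by apply: nneseries_ge0. Qed.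

Lemma low_overlap_count_measurable O : measurable_fun setT (low_overlap_count O).
Proof.
apply: ge0_emeasurable_sum => // j _.
by apply/measurable_EFinP; apply: measurable_indic; exact: low_overlap_measurable.
Qed.

(** The j-th set has measure O(2^-j). *)
Lemma low_overlap_count_integral O : orthogonalmx O ->
  (\int[lambda]_V low_overlap_count O V <= (2 * (r * n)%:R)%:E)%E.
Proof.
move=> oO; rewrite integral_nneseries//; last first.
  by move=> j; apply/measurable_EFinP; apply: measurable_indic; exact: low_overlap_measurable.
have cv := @cvg_geometric_eseries_half R (2 * (r * n)%:R) 0.
rewrite expr0 divr1 in cv; rewrite -(cvg_lim _ cv)//.
apply: lee_nneseries => [j _ _|j _].
  by apply: integral_ge0 => V _; rewrite lee_fin.
rewrite integral_indic//; last exact: low_overlap_measurable.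
rewrite setIT; apply: le_trans (low_overlap_tail oO _) _; first by rewrite expn_gt0.
have -> : (2 ^ (j + 1))%:R = 2 * (2 ^ j)%:R :> R by rewrite addn1 expnS natrM.
by rewrite lee_fin invfM mulrACA divff// mul1r lexx.
Qed.

(** Minus the logarithm of the level at N = 2^j is log_const + log_slope * j. *)
Definition log_const : R := r%:R * (ln 2 + n%:R * ln 5) + ln (@norm_bound R d).
Definition log_slope : R := r%:R * n%:R * ln 2.

Let d0 : (0 < d)%N. Proof. by case/andP: hk => _; exact: leq_ltn_trans. Qed.

Lemma norm_bound_ge1 : 1 <= @norm_bound R d.
Proof. by rewrite !exprn_ege1// ler1n. Qed.

Lemma log_const_ge0 : 0 <= log_const.
Proof.
rewrite addr_ge0 ?ln_ge0 ?norm_bound_ge1// mulr_ge0// addr_ge0 ?mulr_ge0// ln_ge0//.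
  by rewrite ler1n.
by rewrite ler1n.
Qed.

Lemma log_slope_gt0 : 0 < log_slope.
Proof.
have r0 : (0 < r)%N by rewrite muln_gt0 d0.
have n0 : (0 < n)%N by rewrite muln_gt0 addn_gt0 muln_gt0 d0.
by rewrite !mulr_gt0 ?ltr0n// ln_gt0// ltr1n.
Qed.

Lemma level_gt0 N : (0 < N)%N -> 0 < level N.
Proof.
move=> N0; rewrite divr_gt0 ?(lt_le_trans _ norm_bound_ge1)// exprn_gt0// invr_gt0 mulr_gt0//.
by rewrite exprn_gt0// mulr_gt0// ltr0n.
Qed.

Lemma ln_level j : - ln (level (2 ^ j)%N) = log_const + log_slope * j%:R.
Proof.
have p0 : 0 < (2 ^ j)%:R :> R by rewrite ltr0n expn_gt0.
have tb0 : 0 < @norm_bound R d by rewrite (lt_le_trans _ norm_bound_ge1).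
have q0 : 0 < 5 * (2 ^ j)%:R :> R by rewrite mulr_gt0.
have q1 : 0 < (5 * (2 ^ j)%:R) ^+ n :> R by rewrite exprn_gt0.
have lnX (x : R) l : 0 < x -> ln (x ^+ l) = l%:R * ln x.
  by move=> x0; rewrite lnXn// mulr_natl.
have e1 : ln (2 * (5 * (2 ^ j)%:R) ^+ n) = ln 2 + n%:R * (ln 5 + j%:R * ln 2) :> R.
  rewrite lnM ?posrE// (lnX _ n q0) lnM ?posrE//.
  by congr (_ + _ * (_ + _)); rewrite natrX (lnX _ j (ltr0n _ 2)).
have s0 : 0 < shrinkage (2 ^ j)%N n :> R.
  by rewrite invr_gt0 mulr_gt0.
rewrite /level ln_div ?posrE ?exprn_gt0 ?ltr0n// (lnX _ r s0) /shrinkage lnV ?posrE ?mulr_gt0// e1.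
by rewrite /log_const /log_slope; move: (r%:R : R) (n%:R : R) (ln 2 : R) (ln 5 : R) (ln _ : R) (j%:R : R) => *; ring.
Qed.

Lemma low_overlap_count_ge O V j :
  (forall i, (i < j)%N -> overlap (cproj O m) (proj (sel V)) < level (2 ^ i)%N) ->
  (j%:R%:E <= low_overlap_count O V)%E.
Proof.
move=> h; apply: le_trans (nneseries_lim_ge j _); last by move=> *; rewrite lee_fin.
rewrite sumEFin lee_fin big_mkord (eq_bigr (fun=> 1)); last first.
  by move=> i _; rewrite indicE mem_set//; exact: h.
by rewrite sumr_const card_ord.
Qed.

(** If i is the first level that the overlap reaches, then it lies below the i
    earlier ones, so the count is at least i; if it reaches none, then the count
    is infinite. *)
Lemma overlap_log O V (g := overlap (cproj O m) (proj (sel V))) : orthogonalmx O ->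
  low_overlap_count O V = +oo%E \/
  0 < g /\ ((- ln g)%:E <= log_const%:E + log_slope%:E * low_overlap_count O V)%E.
Proof.
move=> oO; have [/= [j gj]|all_bad] := pselect (exists j, level (2 ^ j)%N <= g).
  right; pose good j := level (2 ^ j)%N <= g.
  have ex : exists j, good j by exists j.
  case: (ex_minnP ex) => i gi imin; have g0 : 0 < g.
    by apply: lt_le_trans gi; rewrite level_gt0// expn_gt0.
  split=> //; have hi : (i%:R%:E <= low_overlap_count O V)%E.
    apply: low_overlap_count_ge => l li; rewrite ltNge; apply/negP => gl.
    by have := imin l gl; rewrite leqNgt li.
  apply: (@le_trans _ _ (log_const%:E + log_slope%:E * i%:R%:E)%E).
    rewrite -EFinM -EFinD lee_fin -ln_level lerN2 ler_ln ?posrE//.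
    by rewrite level_gt0// expn_gt0.
  by rewrite leeD2l// lee_wpmul2l// lee_fin ltW// log_slope_gt0.
left; apply/eqyP => A A0.
have [j Aj] : exists j, A <= j%:R.
  exists (Num.bound A); by rewrite ltW// archi_boundP// ltW.
apply: (@le_trans _ _ j%:R%:E); first by rewrite lee_fin.
apply: low_overlap_count_ge => i _; rewrite ltNge; apply/negP => h.
by apply: all_bad; exists i.
Qed.

Lemma overlap_log_dominated O : orthogonalmx O -> exists S : borelPF R hk -> \bar R,
  [/\ forall V, (0 <= S V)%E, measurable_fun setT S,
      (\int[lambda]_V S V <= (2 * ((d * d) * @overlap_degree d)%:R)%:E)%E &
      forall V, S V = +oo%E \/ 0 < overlap (cproj O m) (proj (sel V)) /\
        ((- ln (overlap (cproj O m) (proj (sel V))))%:E <= log_const%:E + log_slope%:E * S V)%E].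
Proof.
move=> oO; exists (low_overlap_count O); split.
- exact: low_overlap_count_ge0.
- exact: low_overlap_count_measurable.
- exact: low_overlap_count_integral.
- by move=> V; exact: overlap_log.
Qed.

End Tail.

(** * The comparison for random flags *)

(** The topology on flags is the one induced by flag_proj. *)
Lemma flag_proj_continuous (R : realType) d k (hk : (1 <= k < d)%N) :
  continuous (@flag_proj R d k hk).
Proof. exact: initial_continuous. Qed.

Lemma flag_proj1_continuous (R : realType) d k (hk : (1 <= k < d)%N) i j :
  continuous (fun V : PF R hk => proj (val V).1 i j).
Proof.
move=> V; apply: (@continuous_comp _ _ _ (fun V => (@flag_proj R d k hk V).1) (fun M : 'M[R]_d => M i j)).
  apply: (@continuous_comp _ _ _ (@flag_proj R d k hk) fst); [exact: flag_proj_continuous|exact: cvg_fst].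
exact: coord_continuous.
Qed.

Lemma flag_proj2_continuous (R : realType) d k (hk : (1 <= k < d)%N) i j :
  continuous (fun V : PF R hk => proj (val V).2 i j).
Proof.
move=> V; apply: (@continuous_comp _ _ _ (fun V => (@flag_proj R d k hk V).2) (fun M : 'M[R]_d => M i j)).
  apply: (@continuous_comp _ _ _ (@flag_proj R d k hk) snd); [exact: flag_proj_continuous|exact: cvg_snd].
exact: coord_continuous.
Qed.

(** Also when the second singular value vanishes: the quotient is then 0, and so is
    its logarithm. *)
Lemma ln_singular_ratio_ge0 (R : realType) d (A : 'M[R]_d) i : (i.+1 < d)%N ->
  0 <= ln (singular_value A i.+1 / singular_value A i.+2).
Proof.
move=> id; have [ O [ _ _ s_dec s_ge0]] := singular_basis_exists A.
have := s_dec (Ordinal (ltnW id)) (Ordinal id) (leqnSn i) => /= s21.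
have := s_ge0 i.+2; rewrite le_eqVlt => /orP[/eqP <-|s2].
  by rewrite invr0 mulr0 ln0.
by rewrite ln_ge0// ler_pdivlMr// mul1r.
Qed.

Theorem proposition4p6 (R : realType) (d : nat) :
  exists C : R, forall (B : 'M[R]_d), B \in unitmx ->
  forall (k : nat) (hk : (1 <= k < d)%N)
    (lambda : probability (borelPF R hk) R), is_haar lambda ->
  (`| \int[lambda]_V
        (ln (singular_value (mxrestr B (val V).2 (val V).1) 1
             / singular_value (mxrestr B (val V).2 (val V).1) 2))%:E
      - (ln (singular_value B k / singular_value B k.+1))%:E | <= C%:E)%E.
Proof.
pose c : R := 2 * ((d * d) * @overlap_degree d)%:R; pose C0 := @log_const R d; pose C1 := @log_slope R d.
exists (ln 2 + 2 * C0 + C1 * (c + c)) => B Bu [//|m] hk lambda haar.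
have C1_gt0 : 0 < C1 := log_slope_gt0 hk.
have C0_ge0 : 0 <= C0 := log_const_ge0 hk.
have [ O svdB] := singular_basis_exists B; have [ oO _ _ _] := svdB.
pose sel1 (V : PF R hk) := (val V).1; pose sel2 (V : PF R hk) := (val V).2.
have dim1 V : \dim (sel1 V) = m by case/and3P: (valP V) => _ /eqP.
have dim2 V : \dim (sel2 V) = m.+2 by case/and3P: (valP V) => _ _ /eqP.
have act1 Q V : sel1 (flag_act Q V) = mximg (val Q) (sel1 V) by [].
have act2 Q V : sel2 (flag_act Q V) = mximg (val Q) (sel2 V) by [].
have cont1 := @flag_proj1_continuous R d _ hk; have cont2 := @flag_proj2_continuous R d _ hk.
have [S1 [S1_ge0 mS1 iS1 log1]] := overlap_log_dominated haar cont1 act1 dim1 oO.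
have [S2 [S2_ge0 mS2 iS2 log2]] := overlap_log_dominated haar cont2 act2 dim2 oO.
rewrite -/c in iS1 iS2; rewrite -/C0 -/C1 in log1 log2; clearbody C0 C1 c.
have K0 : 0 <= ln 2 + 2 * C0 by rewrite addr_ge0 ?mulr_ge0// ln_ge0// ler1n.
pose H V := ((ln 2 + 2 * C0)%:E + (C1)%:E * (S1 V + S2 V))%E.
have H_ge0 V : (0 <= H V)%E.
  by rewrite adde_ge0 ?mule_ge0 ?adde_ge0 ?lee_fin// ltW.
pose f V := ln (singular_value (mxrestr B (sel2 V) (sel1 V)) 1
             / singular_value (mxrestr B (sel2 V) (sel1 V)) 2).
pose L := ln (singular_value B m.+1 / singular_value B m.+2).
(* When one of the counts is infinite nothing has to be shown; otherwise both overlaps are positive and the deterministic comparison applies. *)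
have close V : H V = +oo%E \/ exists2 h : R, H V = h%:E & `|f V - L| <= h.
  have := log1 V; have := log2 V.
  have := S1_ge0 V; have := S2_ge0 V; rewrite /H -/(S1 V) -/(S2 V).
  case: (S2 V) => [r2| |]//; last first.
    move=> _ h1 _ _; left; rewrite addey; last by case: (S1 V) h1.
    by rewrite gt0_muley ?lte_fin// addey.
  case: (S1 V) => [r1| |]// _ _; last by left; rewrite addye// gt0_muley ?lte_fin// addey.
  move=> [//|[b0 hb]] [//|[a0 ha]]; right.
  exists (ln 2 + 2 * C0 + C1 * (r1 + r2)); first by rewrite !EFinD EFinM EFinD.
  have [UV _ _] := and3P (valP V).
  have [_ a1 tU] := transverse_overlap m (sel1 V) oO.
  have [_ b1 tV] := transverse_overlap m.+2 (sel2 V) oO.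
  apply: le_trans (ln_ratio_close Bu svdB UV (dim1 V) (dim2 V) a0 b0 tU tV a1 b1) _.
  move: ha hb; rewrite -!EFinM -!EFinD !lee_fin mulrDr => ha hb; lra.
apply: (@integral_close _ _ _ lambda f L _ H).
- by move=> V; apply: ln_singular_ratio_ge0; have [_] := andP hk; exact: leq_ltn_trans.
- by apply: ln_singular_ratio_ge0; have [_] := andP hk.
- exact: H_ge0.
- apply: emeasurable_funD => //; apply: measurable_funeM; exact: emeasurable_funD.
- rewrite ge0_integralD//; last 2 first.
  + by move=> V _; rewrite mule_ge0 ?adde_ge0 ?lee_fin// ltW.
  + by apply: measurable_funeM; exact: emeasurable_funD.
  rewrite integral_cst// [X in (_ * X)%E]probability_setT mule1 [leRHS]EFinD leeD2l//.
  rewrite ge0_integralZl//; last 3 first.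
  + exact: emeasurable_funD.
  + by move=> V _; rewrite adde_ge0.
  + by rewrite lee_fin ltW.
  rewrite EFinM; apply: lee_wpmul2l; first by rewrite lee_fin ltW.
  by rewrite ge0_integralD// [leRHS]EFinD leeD//.
- move=> V; have [->|[h -> fL]] := close V; first by rewrite addey ?leey.
  by rewrite -EFinD lee_fin; move: fL; rewrite ler_norml => /andP[? ?]; lra.
- move=> V; have [->|[h -> fL]] := close V; first by rewrite addey ?leey.
  by rewrite -EFinD lee_fin; move: fL; rewrite ler_norml => /andP[? ?]; lra.
Qed.
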